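(* Let $G$ be an infinite Ramanujan graph, that is, an infinite connected $d$-regular multigraph (for some $d$) with spectral radius $\rho(G)=2\sqrt{d-1}/d$, and let $L\ge 1$. For simple random walk on $G$ started at any fixed vertex, let $q_n$ be the probability that the walk at time $n$ lies on a nontrivial cycle of length at most $L$. Then $\lim_{n\to\infty}q_n=0$.
   Context: Conventions. Graphs are infinite, connected, locally finite, undirected multigraphs (loops and multiple edges allowed). Each nonloop edge has two orientations; a loop has only one orientation. An oriented edge $e$ goes from its tail $e^-$ to its head $e^+$ (equal if $e$ is a loop), and $-e$ denotes its reversal, with $-e=e$ iff $e$ is a loop. The degree of a vertex $x$ is the number of oriented edges with tail $x$ (a loop counts once). Simple random walk at each step traverses an oriented edge chosen uniformly among those whose tail is the current vertex. The spectral radius is $\rho(G)=\limsup_{n\to\infty}p_n(o,o)^{1/n}$, where $p_n(x,y)$ is the $n$-step transition probability of simple random walk; it does not depend on the vertex $o$. A path is a sequence of oriented edges $(e_1,\dots,e_k)$ with $e_i^+=e_{i+1}^-$; it is a cycle of length $k$ if $k\ge1$ and $e_k^+=e_1^-$. A cycle is nontrivial if, when backtracks (consecutive pairs $e,-e$) are erased iteratively, some edge remains. The walk at time $n$ ''lies on a nontrivial cycle of length at most $L$'' if the vertex it occupies at time $n$ is a vertex of some nontrivial cycle of length at most $L$ in $G$. *)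

(* Defs.v *)
From HB Require Import structures.
From mathcomp Require Import all_boot all_order all_algebra.
From mathcomp Require Import all_classical all_reals all_analysis.
Set Implicit Arguments.
Unset Strict Implicit.
Unset Printing Implicit Defensive.
Import Order.TTheory GRing.Theory Num.Theory.
Import numFieldNormedType.Exports.
Local Open Scope classical_set_scope.
Local Open Scope ring_scope.

(** [oedge] is the type of oriented edges: a nonloop edge contributes two
    elements, exchanged by [flip], and a loop contributes one, fixed by [flip]
    (the converse, that [flip e = e] forces a loop, follows from [tail_flip]).
    Local finiteness is the data of the finite list [out x] of all oriented
    edges with tail [x]. *)
Record multigraph := Multigraph {
  vertex : choiceType;
  oedge : choiceType;
  tail : oedge -> vertex;
  head : oedge -> vertex;
  flip : oedge -> oedge;
  out : vertex -> seq oedge;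
  flipK : involutive flip;
  tail_flip : forall e, tail (flip e) = head e;
  flip_loop : forall e, tail e = head e -> flip e = e;
  out_uniq : forall x, uniq (out x);
  mem_out : forall x e, (e \in out x) = (tail e == x)
}.

Section Graph.
Variable G : multigraph.
Implicit Types (x y : vertex G) (e : oedge G) (p c : seq (oedge G)).

Definition deg x : nat := size (out x).

Definition regular (d : nat) : Prop := forall x, deg x = d.

Definition infinite_graph : Prop := infinite_set [set: vertex G].

Definition consecutive : rel (oedge G) := fun e f => head e == tail f.

Definition connected_graph : Prop :=
  forall x y, x = y \/
    exists e p, [/\ path consecutive e p, tail e = x & head (last e p) = y].

(** [path.cycle consecutive [:: e_1; ...; e_k]] also requires
    [head e_k = tail e_1]. *)
Definition is_cycle c : Prop := c <> [::] /\ path.cycle consecutive c.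

Inductive erases : seq (oedge G) -> seq (oedge G) -> Prop :=
| erases_refl p : erases p p
| erases_backtrack p e q r :
    erases (p ++ q) r -> erases (p ++ [:: e, flip e & q]) r.

(** The final result of iterated erasure does not depend on the order of the
    erasures, so some edge remains iff one cannot erase down to [[::]]. *)
Definition nontrivial c : Prop := ~ erases c [::].

(** In a cycle every head of an edge is also the tail of an edge. *)
Definition on_short_cycle (L : nat) x : Prop :=
  exists c, [/\ is_cycle c, nontrivial c, (size c <= L)%N &
                x \in [seq tail e | e <- c]].

(** All possible trajectories of the first [n] steps from [x]. *)
Fixpoint walks (n : nat) x : seq (seq (oedge G)) :=
  if n is m.+1
  then flatten [seq [seq e :: p | p <- walks m (head e)] | e <- out x]
  else [:: [::]].

Definition position x p : vertex G := last x [seq head e | e <- p].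

End Graph.

Section RandomWalk.
Variables (R : realType) (G : multigraph).
Implicit Types x y : vertex G.

(** Probability that the first [n] steps of the walk from [x] satisfy [ev]:
    each step out of a vertex [v] has conditional probability [1 / deg v]. *)
Definition srw_prob (n : nat) x (ev : seq (oedge G) -> Prop) : R :=
  \sum_(p <- walks n x | `[< ev p >]) \prod_(e <- p) (deg (tail e))%:R^-1.

Definition trans_prob (n : nat) x y : R :=
  srw_prob n x (fun p => position x p = y).

(** The term of index [0] of the sequence is irrelevant for the limsup. *)
Definition spectral_radius x : \bar R :=
  limn_esup (fun n => (trans_prob n x x `^ (n%:R^-1))%:E).

Definition short_cycle_prob (L n : nat) x : R :=
  srw_prob n x (fun p => on_short_cycle L (position x p)).

(** The spectral radius does not depend on the vertex at which it is computed,
    so it is enough to prescribe it at one vertex. *)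
Definition infinite_ramanujan (d : nat) : Prop :=
  [/\ infinite_graph G, connected_graph G, regular G d &
      exists o : vertex G,
        spectral_radius o = (2 * Num.sqrt (d%:R - 1) / d%:R)%:E].

End RandomWalk.

(* Main.v *)
Require Import Defs.
From mathcomp Require Import all_boot all_order all_algebra.
From mathcomp Require Import all_classical all_reals all_analysis.
From mathcomp Require Import zify ring lra.
Import Order.TTheory GRing.Theory Num.Theory.
Import numFieldNormedType.Exports.
Import Defs.
Local Open Scope classical_set_scope.
Local Open Scope ring_scope.

(** Let q = d - 1, let A be the adjacency operator, and call S the set of vertices
    on a nontrivial cycle of length at most L. Short cycles make nonbacktracking
    walks collide, and a Ramanujan graph leaves little room for collisions.

    The spectral radius bounds the number of closed walks, hence the norm of A:
    |A m|^2 <= 4 q |m|^2 for finitely supported m ([growth_bound],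
    [dot_adjm_le]). Let F_k be the sum of the point masses at the ends of the
    nonbacktracking walks of length k from a vertex, and f_k = q^(-k/2) F_k. Then
    f_(k+2) = q^(-1/2) A f_(k+1) - f_k for k >= 1. This recursion conserves a
    quadratic energy, which the norm bound compares with the square of
    |f_(k+1)| - |f_k| ([energyS], [energy_ge]). So |f_k| grows at most linearly in
    k, and the number of pairs of nonbacktracking walks from one vertex with the
    same end, one of length n and the other of length at most n, is at most q^n
    times a polynomial in n, uniformly in the vertex.

    Let d >= 3. If some nonbacktracking walk continuing an edge e ends in S after
    2L + 1 steps, then e has two continuations of bounded length that end with
    the same edge and can be exchanged in any longer walk ([short_cycle_switch]).
    A walk with J such places can be rerouted in 2^J ways without moving its ends,
    so the mean of 2^J over walks of length n is polynomial in n ([npairs_le]) and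
    the mean of J is O(log n). As each visit to S creates such a place with
    probability bounded below, nonbacktracking walk spends a vanishing proportion
    of its time in S, uniformly in its starting point ([nb_cesaro]). For d = 2 a
    nonbacktracking walk is deterministic and can turn around only once
    ([line_cesaro]); an infinite connected graph has no smaller degree.

    Simple random walk inherits this. Nonbacktracking means commute with the
    transition operator P and are dominated by multiples of its powers. If the
    supremum of P^n 1_S decreased to m > 0, then at a vertex where a late P^n 1_S
    is almost maximal, all its nonbacktracking means over bounded even lengths
    would exceed m / 2 at a slightly earlier time; but they are P^n-means of
    nonbacktracking means of 1_S, which are small on average
    ([srw_mean_small]). *)

Set Implicit Arguments.
Unset Strict Implicit.
Unset Printing Implicit Defensive.

(** * Nonbacktracking walks and short cycles *)

Section Walks.
Variable G : multigraph.
Implicit Types (x y : vertex G) (e f g : oedge G) (p q w c : seq (oedge G)).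

Lemma head_flip e : head (flip e) = tail e.
Proof. by rewrite -tail_flip flipK. Qed.

(** A loop is its own reversal, so a nonbacktracking walk never runs through
    the same loop twice in a row. *)
Definition nbnext e : seq (oedge G) := [seq f <- out (head e) | f != flip e].

Definition nbstep : rel (oedge G) := fun e f => f \in nbnext e.

Lemma nbstepE e f : nbstep e f = (f != flip e) && (tail f == head e).
Proof. by rewrite /nbstep /nbnext mem_filter mem_out. Qed.

Lemma nbstep_tail e f : nbstep e f -> tail f = head e.
Proof. by rewrite nbstepE => /andP[_ /eqP]. Qed.

Lemma nbstep_flip e f : nbstep e f -> nbstep (flip f) (flip e).
Proof.
rewrite !nbstepE flipK tail_flip head_flip => /andP[nef /eqP->].
by rewrite eqxx andbT; apply: contra nef => /eqP<-.
Qed.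

Lemma nbnext_uniq e : uniq (nbnext e).
Proof. exact/filter_uniq/out_uniq. Qed.

Lemma size_nbnext d e : regular G d -> size (nbnext e) = d.-1.
Proof.
move=> reg; rewrite /nbnext.
have := count_predC (pred1 (flip e)) (out (head e)).
rewrite -/(deg (head e)) reg count_uniq_mem ?out_uniq// mem_out tail_flip eqxx /=.
by rewrite size_filter => <-.
Qed.

Fixpoint nbcont (k : nat) e : seq (seq (oedge G)) :=
  if k is k'.+1 then [seq f :: p | f <- nbnext e, p <- nbcont k' f] else [:: [::]].

Lemma mem_nbcont k e p : (p \in nbcont k e) = (size p == k) && path nbstep e p.
Proof.
elim: k e p => [|k IH] e p /=; first by case: p.
apply/allpairsPdep/idP => [[f [p' [fe p'c ->]]]|].
  by move: p'c; rewrite IH /= eqSS => /andP[-> ->]; rewrite andbT.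
case: p => [//|f p]; rewrite /= eqSS => /and3P[sp ef pf].
by exists f, p; rewrite IH sp pf.
Qed.

Lemma nbcont_uniq k e : uniq (nbcont k e).
Proof.
elim: k e => [//|k IH] e /=.
apply: allpairs_uniq_dep; [exact: nbnext_uniq|by move=> *; exact: IH|].
by move=> [f p] [f' p'] _ _ /= [-> ->].
Qed.

Fixpoint walk x p : bool :=
  if p is e :: p' then (tail e == x) && walk (head e) p' else true.

Lemma position_cat x p p' : position x (p ++ p') = position (position x p) p'.
Proof. by rewrite /position map_cat last_cat. Qed.

Lemma walk_cat x p p' : walk x (p ++ p') = walk x p && walk (position x p) p'.
Proof. by elim: p x => [//|e p IH] x /=; rewrite IH andbA. Qed.

Lemma positionE e p : position (head e) p = head (last e p).
Proof. by rewrite /position last_map. Qed.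

Lemma walk_consecutive e p : path (@consecutive G) e p -> walk (head e) p.
Proof.
by elim: p e => [//|f p IH] e /= /andP[/eqP-> /IH->]; rewrite eqxx.
Qed.

Definition reverse p := rev (map (@flip G) p).

Lemma reverse_cons e p : reverse (e :: p) = rcons (reverse p) (flip e).
Proof. by rewrite /reverse /= rev_cons. Qed.

Lemma reverse_rcons e p : reverse (rcons p e) = flip e :: reverse p.
Proof. by rewrite /reverse map_rcons rev_rcons. Qed.

Lemma size_reverse p : size (reverse p) = size p.
Proof. by rewrite size_rev size_map. Qed.

Lemma walk_reverse x p : walk x p ->
  walk (position x p) (reverse p) /\ position (position x p) (reverse p) = x.
Proof.
elim: p x => [//|e p IH] x /= /andP[/eqP xe /IH[wp pp]].
rewrite reverse_cons -cats1 walk_cat position_cat.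
have -> : position x (e :: p) = position (head e) p by [].
by rewrite wp pp /= tail_flip eqxx /position /= head_flip.
Qed.

Lemma walk_backtrack x p : walk x p -> ~~ sorted nbstep p ->
  exists a e b, p = a ++ [:: e, flip e & b].
Proof.
case: p => [//|e p] /= /andP[_]; elim: p e => [//|f p IH] e.
rewrite /= => /andP[/eqP ef wp]; rewrite negb_and => /orP[|np].
  rewrite nbstepE ef eqxx andbT negbK => /eqP->.
  by exists [::], e, p.
by have [a [g [b ->]]] := IH _ wp np; exists (e :: a), g, b.
Qed.

Lemma walk_erase x a e b : walk x (a ++ [:: e, flip e & b]) ->
  walk x (a ++ b) /\
  position x (a ++ b) = position x (a ++ [:: e, flip e & b]).
Proof.
rewrite !walk_cat /= !position_cat tail_flip eqxx head_flip /=.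
case/and3P => -> /eqP te wb; rewrite -te wb; split => //.
by rewrite /position /= head_flip.
Qed.

(** Each erasure shortens the walk and keeps its ends, so erasing stops at a
    nonbacktracking walk. *)
Lemma erases_nb x p : walk x p -> exists p',
  [/\ erases p p', walk x p', sorted nbstep p', (size p' <= size p)%N &
      position x p' = position x p].
Proof.
have [n] := ubnP (size p); elim: n p => [//|n IH] p /ltnSE spn wp.
have [sp|nsp] := boolP (sorted nbstep p); first by exists p; split=> //; constructor.
have [a [e [b def_p]]] := walk_backtrack wp nsp.
have sab : (size (a ++ b)).+2 = size p by rewrite def_p !size_cat /= !addnS.
have [wab pab] : walk x (a ++ b) /\ position x (a ++ b) = position x p.
  by rewrite def_p; apply: walk_erase; rewrite -def_p.
have [|p' [er w' s' sz pos']] := IH (a ++ b) _ wab.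
  by move: spn; rewrite -sab => /ltnW.
exists p'; split=> //; last by rewrite pos'.
- by rewrite def_p; constructor.
- by apply: leq_trans sz _; rewrite -sab ltnW// ltnW.
Qed.

(** When two nonbacktracking walks are joined, all that cancels is a final
    segment [w2] of the first against its reversal at the start of the second;
    the assumption on the sizes keeps [e] from being cancelled. *)
Lemma nb_concat e w c :
  path nbstep e w -> sorted nbstep c -> walk (head (last e w)) c ->
  (size c <= size w)%N ->
  exists w1 w2 c3, [/\ w = w1 ++ w2, c = reverse w2 ++ c3,
    path nbstep e (w1 ++ c3) &
    head (last e (w1 ++ c3)) = position (head (last e w)) c].
Proof.
elim: c w => [|f c IH] w pw sc wc szc.
  by exists w, [::], [::]; rewrite cats0.
have [ff|nf] := eqVneq f (flip (last e w)); last first.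
  exists w, [::], (f :: c); rewrite cats0; split=> //.
    rewrite cat_path pw /= nbstepE nf /=.
    by move: wc => /= /andP[/eqP-> _]; rewrite eqxx.
  by rewrite last_cat /= -positionE.
case: (lastP w) pw szc ff wc => [//|w' g] pw szc ff wc.
rewrite last_rcons in ff; subst f.
move: pw; rewrite rcons_path => /andP[pw' nwg].
have hd : head (flip g) = head (last e w').
  by rewrite head_flip; apply: nbstep_tail.
have [||||w1 [w2 [c3 [dw dc pc pos]]]] := IH w' _ _ _ _ => //.
- exact: (path_sorted sc).
- by move: wc => /= /andP[_]; rewrite hd.
- by move: szc; rewrite size_rcons.
exists w1, (rcons w2 g), c3; split=> //.
- by rewrite dw rcons_cat.
- by rewrite reverse_rcons dc.
- by rewrite pos -hd.
Qed.

(** A nonempty nonbacktracking walk [reverse w2 ++ c3] changes the walk that it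
    is joined to: with [c3 = w2] it would backtrack in the middle. *)
Lemma nb_concat_neq w1 w2 c3 : sorted nbstep (reverse w2 ++ c3) ->
  reverse w2 ++ c3 <> [::] -> w1 ++ c3 <> w1 ++ w2.
Proof.
move=> sc nc /(congr1 (drop (size w1))); rewrite !drop_size_cat// => def_c.
move: sc nc; rewrite {c3}def_c; case: w2 => [//|g w2] sc _.
move: sc; rewrite reverse_cons cat_rcons sorted_cat_cons.
by rewrite /= nbstepE flipK eqxx !andbF.
Qed.


(** From the end of [w] one can walk back along the cycle to its base point and
    stop there, or run once more through the reduced cycle. Both routes, after
    cancellation, still continue [e], since [w] is at least as long as what
    the two walks of length at most [L] can cancel. They differ because the
    reduced cycle is not empty. *)
Lemma short_cycle_collision L e w :
  path nbstep e w -> (L.*2 <= size w)%N ->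
  on_short_cycle L (head (last e w)) ->
  exists a b, [/\ path nbstep e a, path nbstep e b, a <> b,
    head (last e a) = head (last e b) &
    (size a <= L.*2 + size w)%N /\ (size b <= L.*2 + size w)%N].
Proof.
move=> pw szw [c [[c0 cyc] nt szc xc]].
case: c c0 cyc nt szc xc => [//|e1 c] _ cyc nt szc xc.
set v := head (last e w) in xc *; set u := tail e1.
move: cyc; rewrite /= rcons_path /consecutive => /andP[pc /eqP cl].
have wc : walk u (e1 :: c) by rewrite /= eqxx walk_consecutive.
have posc : position u (e1 :: c) = u.
  by rewrite -[LHS]/(position (head e1) c) positionE.
(* a reduced walk from v back to the base point u of the cycle *)
have [b [wb sb szb pb]] : exists b,
    [/\ walk v b, sorted nbstep b, (size b <= L)%N & position v b = u].
  have [g gc vg] := mapP xc.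
  move: wc; rewrite -(cat_take_drop (index g (e1 :: c)) (e1 :: c)).
  rewrite walk_cat => /andP[wt wd].
  have pt : position u (take (index g (e1 :: c)) (e1 :: c)) = v.
    move: wd; rewrite (drop_nth g) ?index_mem// nth_index//=.
    by rewrite vg => /andP[/eqP->].
  have [] := walk_reverse wt; rewrite pt => wr pr.
  have [b [_ wb sb szb pb]] := erases_nb wr.
  exists b; split=> //; last by rewrite pb.
  apply: leq_trans szb _; rewrite size_reverse.
  apply: leq_trans szc; rewrite size_take; case: ifP => // /ltnW //.
have [r [er wr sr szr pr]] := erases_nb wc.
have r0 : r <> [::] by move=> r0; apply: nt; rewrite -r0.
have {}szr : (size r <= L)%N by apply: leq_trans szr szc.
have [|w1 [w2 [c3 [dw db pb' pos]]]] := nb_concat pw sb wb.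
  by apply: leq_trans szb _; lia.
have s1 : (size w1 + size w2 = size w)%N by rewrite dw size_cat.
have s2 : (size w2 + size c3 = size b)%N by rewrite db size_cat size_reverse.
have pu : head (last e (w1 ++ c3)) = u by rewrite pos.
have [||w3 [w4 [c5 [dw' dr pr' pos']]]] := nb_concat pb' sr.
- by rewrite pu.
- by rewrite size_cat; lia.
have s3 : (size w3 + size w4 = size w1 + size c3)%N.
  by rewrite -!size_cat -dw'.
have s4 : (size w4 + size c5 = size r)%N by rewrite dr size_cat size_reverse.
exists (w3 ++ c5), (w1 ++ c3); split=> //.
- by rewrite dw'; apply: nb_concat_neq; rewrite -dr.
- by rewrite pos' pu pr.
- by rewrite !size_cat; lia.
Qed.

End Walks.
Arguments nbstep {G}.

(** * Rerouting a nonbacktracking walk at a short cycle *)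

Section Switch.
Variables (G : multigraph) (d : nat).
Hypothesis reg : regular G d.
Implicit Types (x y : vertex G) (e f g : oedge G) (p q w c : seq (oedge G)).

Lemma out_avoid2 x g h : (2 < d)%N ->
  exists f, [/\ tail f = x, f != g & f != h].
Proof.
move=> d3.
have : (0 < size [seq f <- out x | f \notin [:: g; h]])%N.
  have /eqP := count_predC [pred f | f \in [:: g; h]] (out x).
  rewrite -/(deg x) reg size_filter.
  have : (count [pred f | f \in [:: g; h]] (out x) <= 2)%N.
    rewrite -size_filter -[2%N]/(size [:: g; h]).
    apply: uniq_leq_size; first exact/filter_uniq/out_uniq.
    by move=> f; rewrite mem_filter => /andP[].
  set m := count _ _; rewrite (@eq_count _ (predC _) [pred f | f \notin [:: g; h]])//.
  by set m' := count [pred f | f \notin _] _; lia.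
case E : [seq _ <- _ | _] => [//|f s] _; exists f.
have : f \in [seq f <- out x | f \notin [:: g; h]] by rewrite E mem_head.
rewrite mem_filter mem_out !inE negb_or => /andP[/andP[-> ->]] /eqP ->.
by split.
Qed.

Lemma nb_extend k e : (1 < d)%N -> exists2 p, path nbstep e p & size p = k.
Proof.
move=> d2; elim: k e => [|k IH] e; first by exists [::].
have : (0 < size (nbnext e))%N by rewrite (size_nbnext _ reg); lia.
case E : (nbnext e) => [//|f s] _; have [p pp sp] := IH f.
by exists (f :: p); rewrite /= ?sp// /nbstep E mem_head.
Qed.

(** The two continuations of [e] can be exchanged inside a nonbacktracking walk:
    as their last edges agree, whatever follows one may follow the other. The
    prefix condition makes the two resulting walks different whatever follows. *)
Definition switch (B : nat) e (ab : seq (oedge G) * seq (oedge G)) : Prop :=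
  [/\ path nbstep e ab.1, path nbstep e ab.2, last e ab.1 = last e ab.2,
      size ab.1 = B /\ (size ab.2 <= B)%N & ~~ prefix ab.2 ab.1].

(** In degree at least three both routes can be prolonged by common edges. The
    first, [f], avoids backtracking on either route. The second, [f'], also
    avoids the edge that the longer route takes at the place where the shorter
    one takes [f'], so that the shorter one is not a prefix of the longer. *)
Lemma collision_switch B e a b : (2 < d)%N ->
  path nbstep e a -> path nbstep e b -> a <> b ->
  head (last e a) = head (last e b) ->
  ((size a).+2 <= B)%N -> ((size b).+2 <= B)%N -> exists ab, switch B e ab.
Proof.
move=> d3; wlog ba : a b / (size b <= size a)%N.
  move=> W pa pb nab hab sa sb; have [ba|/ltnW ab] := leqP (size b) (size a).
    exact: (W a b).
  by apply: (W b a) => //; exact: nesym.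
move=> pa pb nab hab sa sb.
have [f [tf fa fb]] :=
  out_avoid2 (head (last e a)) (flip (last e a)) (flip (last e b)) d3.
have [f' [tf' ff ff']] :=
  out_avoid2 (head f) (flip f) (nth f (rcons a f) (size b).+1) d3.
(* padding both routes makes the longer one exactly [B] long *)
have [p pp sp] := nb_extend (B - (size a).+2) f' (ltnW d3).
exists (rcons a f ++ f' :: p, rcons b f ++ f' :: p); split => /=.
- by rewrite cat_path last_rcons rcons_path pa /= pp !nbstepE tf tf' fa ff !eqxx.
- by rewrite cat_path last_rcons rcons_path pb /= pp !nbstepE tf tf' fb ff hab !eqxx.
- by rewrite !last_cat.
- by rewrite !size_cat !size_rcons /= sp; lia.
apply/negP => /prefixP[s]; rewrite -catA => E.
have Eb : take (size (rcons b f)) (rcons a f ++ f' :: p) = rcons b f.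
  by rewrite E take_size_cat.
have Ef : nth f (rcons a f ++ f' :: p) (size b).+1 = f'.
  by rewrite E nth_cat size_rcons ltnn subnn.
move: ba; rewrite leq_eqVlt => /orP[/eqP sba|sba].
  move: Eb; rewrite size_rcons sba -(size_rcons a f) take_size_cat//.
  by move=> /rcons_inj[].
by move: ff'; rewrite -{1}Ef nth_cat size_rcons ltnS sba eqxx.
Qed.

Lemma short_cycle_switch L e w : (2 < d)%N ->
  path nbstep e w -> size w = L.*2.+1 ->
  on_short_cycle L (head (last e w)) ->
  exists ab, switch (L.*2.+2).*2 e ab.
Proof.
move=> d3 pw sw osc.
have [|a [b [pa pb nab hab [sa sb]]]] := short_cycle_collision pw _ osc.
  by rewrite sw.
by apply: (collision_switch d3 pa pb nab hab); lia.
Qed.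

End Switch.

(** * Adjacency and nonbacktracking sums *)

Section Operators.
Variables (R : realType) (G : multigraph).
Implicit Types (x y : vertex G) (e f g : oedge G) (p : seq (oedge G)).
Implicit Types (phi psi : oedge G -> R) (u v : vertex G -> R).

Definition nbsum phi e : R := \sum_(f <- nbnext e) phi f.

Definition adj u x : R := \sum_(e <- out x) u (head e).

Definition nbwalk_sum k u x : R :=
  if k is k'.+1 then \sum_(e <- out x) iter k' nbsum (u \o @head G) e else u x.

Lemma iter_nbsum_nbcont k phi e :
  iter k nbsum phi e = \sum_(p <- nbcont k e) phi (last e p).
Proof.
elim: k e => [|k IH] e; first by rewrite /= big_seq1.
rewrite iterS {1}/nbsum /= big_allpairs_dep /=.
by apply: eq_bigr => f _; rewrite IH.
Qed.

Lemma iter_nbsum_ext k phi psi : phi =1 psi ->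
  iter k nbsum phi =1 iter k nbsum psi.
Proof. by move=> E e; rewrite !iter_nbsum_nbcont; apply: eq_bigr. Qed.

Lemma iter_nbsum_le k phi psi e : (forall f, phi f <= psi f) ->
  iter k nbsum phi e <= iter k nbsum psi e.
Proof. by move=> H; rewrite !iter_nbsum_nbcont ler_sum. Qed.

Lemma iter_nbsumD k phi psi e :
  iter k nbsum (fun f => phi f + psi f) e
  = iter k nbsum phi e + iter k nbsum psi e.
Proof. by rewrite !iter_nbsum_nbcont big_split. Qed.

Lemma iter_nbsumZ k a phi e :
  iter k nbsum (fun f => a * phi f) e = a * iter k nbsum phi e.
Proof. by rewrite !iter_nbsum_nbcont -mulr_sumr. Qed.

Lemma iter_nbsum_sum k (I : Type) (r : seq I) (F : I -> oedge G -> R) e :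
  iter k nbsum (fun f => \sum_(i <- r) F i f) e
  = \sum_(i <- r) iter k nbsum (F i) e.
Proof.
rewrite iter_nbsum_nbcont exchange_big; apply: eq_bigr => i _.
by rewrite iter_nbsum_nbcont.
Qed.

Lemma adj_le u v x : (forall y, u y <= v y) -> adj u x <= adj v x.
Proof. by move=> H; apply: ler_sum. Qed.

Lemma iter_adj_ge0 k u x : (forall y, 0 <= u y) -> 0 <= iter k adj u x.
Proof.
by move=> u0; elim: k x => [//|k IH] x /=; apply: sumr_ge0.
Qed.

Lemma iter_adj_le k u v x : (forall y, u y <= v y) ->
  iter k adj u x <= iter k adj v x.
Proof. by move=> H; elim: k x => [//|k IH] x /=; apply: adj_le. Qed.

Lemma adjB u v x : adj (fun y => u y - v y) x = adj u x - adj v x.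
Proof. by rewrite /adj sumrB. Qed.

Lemma adjZ a u x : adj (fun y => a * u y) x = a * adj u x.
Proof. by rewrite /adj mulr_sumr. Qed.

Lemma adj_ext u v : u =1 v -> adj u =1 adj v.
Proof. by move=> E x; apply: eq_bigr => e _. Qed.

Lemma iter_adj_ext k u v : u =1 v -> iter k adj u =1 iter k adj v.
Proof. by move=> E; elim: k => [//|k IH] x /=; exact: adj_ext. Qed.

Lemma iter_adjB k u v x :
  iter k adj (fun y => u y - v y) x = iter k adj u x - iter k adj v x.
Proof.
elim: k x => [//|k IH] x /=; rewrite -adjB.
by apply: adj_ext => y; exact: IH.
Qed.

Lemma iter_adjZ k a u x : iter k adj (fun y => a * u y) x = a * iter k adj u x.
Proof.
elim: k x => [//|k IH] x /=; rewrite -adjZ.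
by apply: adj_ext => y; exact: IH.
Qed.

Lemma iter_adj_sum k (I : Type) (r : seq I) (F : I -> vertex G -> R) x :
  iter k adj (fun y => \sum_(i <- r) F i y) x = \sum_(i <- r) iter k adj (F i) x.
Proof.
by elim: k x => [//|k IH] x /=; rewrite (adj_ext IH) /adj exchange_big.
Qed.

Lemma nbwalk_sum_le k u v x : (forall y, u y <= v y) ->
  nbwalk_sum k u x <= nbwalk_sum k v x.
Proof.
case: k => [|k] H /=; first exact: H.
by apply: ler_sum => e _; apply: iter_nbsum_le => f /=.
Qed.

Lemma nbwalk_sumB k u v x : nbwalk_sum k (fun y => u y - v y) x
  = nbwalk_sum k u x - nbwalk_sum k v x.
Proof.
case: k => [//|k] /=; rewrite -sumrB; apply: eq_bigr => e _.
by rewrite !iter_nbsum_nbcont sumrB.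
Qed.

Lemma nbwalk_sumZ k a u x : nbwalk_sum k (fun y => a * u y) x
  = a * nbwalk_sum k u x.
Proof.
case: k => [//|k] /=; rewrite mulr_sumr; apply: eq_bigr => e _.
by rewrite -iter_nbsumZ.
Qed.

(** Nonbacktracking walks are walks. *)
Lemma iter_nbsum_le_adj k u e : (forall y, 0 <= u y) ->
  iter k nbsum (u \o @head G) e <= iter k adj u (head e).
Proof.
move=> u0; elim: k e => [//|k IH] e /=.
apply: (@le_trans _ _ (\sum_(f <- nbnext e) iter k adj u (head f))).
  by apply: ler_sum => f _; exact: IH.
rewrite /adj /nbnext big_filter [leRHS](bigID (fun f => f != flip e)) /= lerDl.
by apply: sumr_ge0 => f _; exact: iter_adj_ge0.
Qed.

Lemma nbwalk_sum_le_adj k u x : (forall y, 0 <= u y) ->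
  nbwalk_sum k u x <= iter k adj u x.
Proof.
case: k => [//|k] u0 /=; apply: ler_sum => e _; exact: iter_nbsum_le_adj.
Qed.

Section Regular.
Variable d : nat.
Hypothesis reg : regular G d.

Lemma iter_nbsum_cst k (a : R) e : iter k nbsum (fun=> a) e = d.-1%:R ^+ k * a.
Proof.
elim: k e => [|k IH] e /=; first by rewrite expr0 mul1r.
rewrite /nbsum (eq_bigr (fun=> d.-1%:R ^+ k * a)) => [|f _]; last exact: IH.
by rewrite big_const_seq count_predT (size_nbnext _ reg) iter_addr_0 exprS -mulrA
  mulr_natl.
Qed.

Lemma adj_cst (a : R) x : adj (fun=> a) x = d%:R * a.
Proof.
rewrite /adj big_const_seq count_predT iter_addr_0.
by rewrite -/(deg x) reg mulr_natl.
Qed.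

Lemma nbwalk_sum_cst k (a : R) x :
  nbwalk_sum k.+1 (fun=> a) x = d%:R * d.-1%:R ^+ k * a.
Proof.
rewrite /= (eq_bigr (fun=> d.-1%:R ^+ k * a)) => [|f _].
  rewrite big_const_seq count_predT iter_addr_0.
  by rewrite -/(deg x) reg -mulrA mulr_natl.
exact: iter_nbsum_cst.
Qed.

Lemma adj_head u e : adj u (head e) = nbsum (u \o @head G) e + u (tail e).
Proof.
rewrite /adj /nbsum /nbnext big_filter (bigD1_seq (flip e)) ?out_uniq//=.
  by rewrite addrC head_flip.
by rewrite mem_out tail_flip.
Qed.

Lemma nbsum_tail u e : nbsum (u \o @tail G) e = d.-1%:R * u (head e).
Proof.
rewrite /nbsum big_seq (eq_bigr (fun=> u (head e))) => [|f fe].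
  by rewrite -big_seq big_const_seq count_predT (size_nbnext _ reg) iter_addr_0
    mulr_natl.
by rewrite /= (nbstep_tail fe).
Qed.

Lemma nbwalk_sum_adj1 u x : nbwalk_sum 1 (adj u) x
  = nbwalk_sum 2 u x + d%:R * u x.
Proof.
rewrite /= big_seq (eq_bigr (fun e => nbsum (u \o @head G) e + u x)) => [|e].
  by rewrite -big_seq big_split /= big_const_seq count_predT iter_addr_0
   -/(deg x) reg mulr_natl.
by rewrite mem_out /= adj_head => /eqP->.
Qed.

(** An arbitrary step after a nonbacktracking walk either prolongs it or cancels
    its last edge; in the second case the walk that remains could have been
    prolonged by any of [d.-1] edges. *)
Lemma nbwalk_sum_adj k u x : nbwalk_sum k.+2 (adj u) x
  = nbwalk_sum k.+3 u x + d.-1%:R * nbwalk_sum k.+1 u x.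
Proof.
rewrite /nbwalk_sum mulr_sumr -big_split; apply: eq_bigr => e _.
transitivity (iter k.+1 nbsum (fun f => nbsum (u \o @head G) f + u (tail f)) e).
  by apply: iter_nbsum_ext => f; exact: adj_head.
rewrite iter_nbsumD; congr (_ + _); first by rewrite (iterSr k.+1).
rewrite iterSr -iter_nbsumZ; apply: iter_nbsum_ext; exact: nbsum_tail.
Qed.

(** By the recursion, the nonbacktracking sums are polynomials in the adjacency
    operator. *)
Lemma nbwalk_sum_comm k u x : nbwalk_sum k (adj u) x = adj (nbwalk_sum k u) x.
Proof.
suff: (forall v y, nbwalk_sum k (adj v) y = adj (nbwalk_sum k v) y) /\
  (forall v y, nbwalk_sum k.+1 (adj v) y = adj (nbwalk_sum k.+1 v) y) by case.
have C1 v y : nbwalk_sum 1 (adj v) y = adj (nbwalk_sum 1 v) y by [].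
elim: k {u x} => [|k [IH0 IH]]; first by split.
split=> // v y.
case: k IH0 IH => [|k] IH0 IH.
  have E w z : nbwalk_sum 2 w z = nbwalk_sum 1 (adj w) z - d%:R * w z.
    by rewrite nbwalk_sum_adj1 addrK.
  rewrite E (adj_ext (E v)) adjB adjZ; congr (_ - _); exact: C1.
have E w z : nbwalk_sum k.+3 w z
    = nbwalk_sum k.+2 (adj w) z - d.-1%:R * nbwalk_sum k.+1 w z.
  by rewrite nbwalk_sum_adj addrK.
rewrite E (adj_ext (E v)) adjB adjZ IH0; congr (_ - _); exact: IH.
Qed.

Lemma nbwalk_sum_iter_adj k n u x :
  nbwalk_sum k (iter n adj u) x = iter n adj (nbwalk_sum k u) x.
Proof.
elim: n u x => [//|n IH] u x; rewrite iterSr IH iterSr.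
by apply: iter_adj_ext => y; exact: nbwalk_sum_comm.
Qed.

End Regular.
End Operators.

(** * Counting reroutings *)

Section SwitchedPairs.
Variables (R : realType) (G : multigraph) (d B : nat).
Hypothesis reg : regular G d.
Hypothesis d2 : (1 < d)%N.
Variables (E : pred (oedge G)) (a b : oedge G -> seq (oedge G)).
Hypothesis Eab : forall e, E e -> switch B e (a e, b e).
Implicit Types (e f : oedge G) (p : seq (oedge G)).

Local Notation q := (d.-1%:R : R).
Local Notation nbsum := (@nbsum R G).

(** The walks made of [M] blocks of length [B], each paired with all its
    reroutings: a block equal to [a e] may be replaced by [b e]. If [J] blocks
    can be replaced, the walk occurs in [2 ^ J] pairs. *)
Fixpoint pairs M e : seq (seq (oedge G) * seq (oedge G)) :=
  if M is M'.+1 then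
    [seq (p ++ u.1, p ++ u.2) | p <- nbcont B e, u <- pairs M' (last e p)] ++
    (if E e then [seq (a e ++ u.1, b e ++ u.2) | u <- pairs M' (last e (a e))]
     else [::])
  else [:: ([::], [::])].

Lemma mem_pairs M e u : u \in pairs M e ->
  [/\ path nbstep e u.1, path nbstep e u.2, size u.1 = (M * B)%N,
      (size u.2 <= M * B)%N & last e u.1 = last e u.2].
Proof.
elim: M e u => [|M IH] e u /=; first by rewrite inE => /eqP->.
rewrite mem_cat => /orP[/allpairsPdep[p [v [pc /IH[p1 p2 s1 s2 l12] ->]]]|].
  move: pc; rewrite mem_nbcont => /andP[/eqP sp pp].
  rewrite /= !cat_path !last_cat !size_cat pp s1 sp mulSn leq_add2l.
  by split.
case: ifP => // Ee /mapP[v /IH[p1 p2 s1 s2 l12] ->].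
have [/= pa pb lab [sa sb] _] := Eab Ee.
rewrite !cat_path !last_cat !size_cat pa pb s1 sa mulSn -lab.
by split=> //; rewrite leq_add.
Qed.

(** Rerouted walks first differ at a block where one follows [a e] and the other
    [b e]; since [b e] is not a prefix of [a e], they never agree afterwards. *)
Lemma pairs_uniq M e : uniq (pairs M e).
Proof.
elim: M e => [//|M IH] e /=; rewrite cat_uniq; apply/and3P; split.
- apply: allpairs_uniq_dep; [exact: nbcont_uniq|by move=> *; exact: IH|].
  move=> [p u] [p' u'] /allpairsPdep[p1 [u1 [p1c _ [-> ->]]]].
  move=> /allpairsPdep[p2 [u2 [p2c _ [-> ->]]]] /= [].
  move: p1c p2c; rewrite !mem_nbcont => /andP[/eqP s1 _] /andP[/eqP s2 _].
  move=> /eqP; rewrite eqseq_cat ?s1 ?s2// => /andP[/eqP-> /eqP e1].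
  move=> /eqP; rewrite eqseq_cat// => /andP[_ /eqP e2].
  by case: u1 u2 e1 e2 => ? ? [? ?] /= -> ->.
- apply/hasPn => u; case: ifP => // Ee /mapP[v _ ->].
  have [/= pa pb lab [sa sb] nab] := Eab Ee.
  apply/negP => /allpairsPdep[p [v' [pc _ [e1 e2]]]].
  have pE : a e = p.
    move: pc e1; rewrite mem_nbcont => /andP[/eqP sp _] /eqP.
    by rewrite eqseq_cat ?sa ?sp// => /andP[/eqP].
  move/negP: nab; apply.
  have : prefix (b e) (a e ++ v'.2) by rewrite pE -e2; exact: prefix_prefix.
  by rewrite !prefixE takel_cat ?sa.
- case: ifP => // Ee; rewrite map_inj_uniq// => -[u1 u2] [v1 v2] /= [].
  move=> /eqP; rewrite eqseq_cat// => /andP[_ /eqP->].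
  by move=> /eqP; rewrite eqseq_cat// => /andP[_ /eqP->].
Qed.

(** The mean of [2 ^ J] over the nonbacktracking walks that continue [e]. *)
Definition npairs M e : R := (q ^+ (M * B))^-1 * (size (pairs M e))%:R.

Let q0 : q != 0.
Proof. by rewrite pnatr_eq0 -lt0n -ltnS prednK// ltnW. Qed.

Let qi n : 0 < (q ^+ n)^-1.
Proof. by rewrite invr_gt0 exprn_gt0// lt0r q0 ler0n. Qed.

Lemma npairsS M e : npairs M.+1 e = (q ^+ B)^-1 *
  (iter B nbsum (npairs M) e + (E e)%:R * npairs M (last e (a e))).
Proof.
rewrite /npairs mulSn exprD invfM -mulrA; congr (_ * _).
rewrite /= size_cat natrD mulrDr; congr (_ + _); last first.
  by case: ifP => _; rewrite ?size_map ?mul1r// mul0r mulr0.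
rewrite size_allpairs_dep iter_nbsum_nbcont sumnE big_map natr_sum mulr_sumr.
by [].
Qed.

Lemma npairs_ge1 M e : 1 <= npairs M e.
Proof.
elim: M e => [|M IH] e; first by rewrite /npairs mul0n expr0 invr1 mul1r.
have -> : 1 = (q ^+ B)^-1 * iter B nbsum (fun=> 1) e :> R.
  by rewrite (iter_nbsum_cst reg) mulr1 mulVf// expf_neq0.
rewrite npairsS ler_wpM2l ?(ltW (qi _))//.
rewrite -[leLHS]addr0 lerD//; first exact: iter_nbsum_le.
by rewrite mulr_ge0// (le_trans _ (IH _)).
Qed.

(** The expected number of block times, among the first [M], at which the last
    edge traversed lies in [E]. At each of them the next block is the replaceable
    one with probability [q ^ - B], so the mean of [J] is [q ^ - B * visits M e]. *)
Definition visits M e : R :=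
  \sum_(i < M) (q ^+ (i * B))^-1 * iter (i * B) nbsum (fun f => (E f)%:R) e.

Lemma visitsS M e : visits M.+1 e =
  (E e)%:R + (q ^+ B)^-1 * iter B nbsum (visits M) e.
Proof.
rewrite /visits big_ord_recl /= expr0 invr1 mul1r; congr (_ + _).
rewrite iter_nbsum_sum mulr_sumr; apply: eq_bigr => i _.
by rewrite iter_nbsumZ /bump /= add1n mulSn iterD exprD invfM mulrA.
Qed.

(** This is the mean of the inequality [J <= T + 2 ^ (J - T)]. The induction on
    the number of blocks uses that [J + 1 <= T + 2 ^ (J + 1 - T)] follows from
    the inequality for [T - 1], or from [1 <= 2 ^ J] if [T = 0]. *)
Lemma visits_le_npairs M T e :
  (q ^+ B)^-1 * visits M e <= T%:R + (2 ^+ T)^-1 * npairs M e.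
Proof.
elim: M T e => [|M IH] T e.
  rewrite /visits big_ord0 mulr0 addr_ge0//.
  by rewrite mulr_ge0// (le_trans _ (npairs_ge1 _ _)).
rewrite visitsS npairsS.
have -> : T%:R = (q ^+ B)^-1 * iter B nbsum (fun=> T%:R) e :> R.
  by rewrite (iter_nbsum_cst reg) mulrA mulVf ?mul1r// expf_neq0.
rewrite [X in _ <= _ + X]mulrCA -mulrDr ler_wpM2l ?(ltW (qi _))//.
rewrite mulrDr addrA -!iter_nbsumZ -iter_nbsumD !iter_nbsum_nbcont addrC.
case: (boolP (E e)) => Ee; last first.
  by rewrite mul0r mulr0 !add0r; apply: ler_sum => p _; exact: IH.
have [/= pa pb lab [sa sb] nab] := Eab Ee.
have ac : a e \in nbcont B e by rewrite mem_nbcont sa eqxx.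
rewrite mul1r (bigD1_seq (a e)) ?nbcont_uniq//=.
rewrite [X in _ <= _ + X](bigD1_seq (a e)) ?nbcont_uniq//= !addrA.
rewrite lerD//; last by apply: ler_sum => p _; exact: IH.
set f := last e (a e); have s1 := npairs_ge1 M f.
case: T => [|T].
  by have := IH 0 f; rewrite expr0 invr1 !mul1r; lra.
have := IH T f; rewrite exprS invfM -natr1.
set z := (2 ^+ T)^-1 * _ => H.
have -> : 2^-1 / 2 ^+ T * npairs M f = 2^-1 * z by rewrite -mulrA.
by lra.
Qed.

End SwitchedPairs.

(** * Finitely supported measures and the norm of the adjacency operator *)

Section Measures.
Variables (R : realType) (G : multigraph).
Implicit Types (x y z : vertex G) (u v : vertex G -> R) (m n : seq (R * vertex G)).

(** A list of weighted vertices stands for a finitely supported measure. A vertex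
    may be repeated, so lists are compared only through their integrals. *)
Definition integ m u : R := \sum_(i <- m) i.1 * u i.2.

Definition dot m n : R := integ m (fun y => integ n (fun z => (y == z)%:R)).

Definition adjm m := [seq (i.1, head e) | i <- m, e <- out i.2].

Lemma integ_cat m n u : integ (m ++ n) u = integ m u + integ n u.
Proof. by rewrite /integ big_cat. Qed.

Lemma integ_scale a m u : integ [seq (a * i.1, i.2) | i <- m] u = a * integ m u.
Proof.
by rewrite /integ big_map mulr_sumr; apply: eq_bigr => i _; rewrite mulrA.
Qed.

Lemma integ_ext m u v : u =1 v -> integ m u = integ m v.
Proof. by move=> E; apply: eq_bigr => i _; rewrite E. Qed.

Lemma integ_adjm m u : integ (adjm m) u = integ m (adj u).
Proof.
rewrite /integ big_allpairs_dep /=; apply: eq_bigr => i _.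
by rewrite mulr_sumr.
Qed.

Lemma integ_iter_adjm k m u : integ (iter k adjm m) u = integ m (iter k (@adj R G) u).
Proof.
by elim: k m => [//|k IH] m; rewrite iterSr IH integ_adjm.
Qed.

Lemma integ_exchange m n (F : vertex G -> vertex G -> R) :
  integ m (fun y => integ n (fun z => F y z)) = integ n (fun z => integ m (fun y => F y z)).
Proof.
rewrite /integ; under eq_bigr do rewrite mulr_sumr.
rewrite exchange_big; apply: eq_bigr => j _; rewrite mulr_sumr.
by apply: eq_bigr => i _; rewrite mulrCA.
Qed.

Lemma dotC m n : dot m n = dot n m.
Proof.
rewrite /dot integ_exchange; apply: integ_ext => z; apply: integ_ext => y.
by rewrite eq_sym.
Qed.

(** Reversal is a bijection between the edges from [x] to [z] and those from [z]
    to [x]. *)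
Lemma adj_delta x z : adj (fun y => (y == z)%:R : R) x = adj (fun y => (x == y)%:R) z.
Proof.
rewrite /adj -!natr_sum; congr (_%:R).
have S (s : seq (oedge G)) (P : pred (oedge G)) :
  (\sum_(e <- s) P e = size (seq.filter P s))%N.
  by rewrite size_filter -sum1_count [RHS]big_mkcond; apply: eq_bigr => e _; case: (P e).
rewrite !S -(size_map (@flip G)); apply/perm_size/uniq_perm.
- by rewrite map_inj_uniq ?filter_uniq ?out_uniq//; exact: (can_inj (@flipK G)).
- exact/filter_uniq/out_uniq.
move=> e; rewrite -[e in LHS]flipK mem_map; last exact: (can_inj (@flipK G)).
by rewrite !mem_filter !mem_out tail_flip head_flip andbC [x == _]eq_sym.
Qed.

Lemma dot_adjm m n : dot (adjm m) n = dot m (adjm n).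
Proof.
rewrite /dot integ_adjm; apply: integ_ext => x.
rewrite integ_adjm {1}/adj.
under eq_bigr do rewrite /integ.
rewrite exchange_big; apply: eq_bigr => i _; rewrite -mulr_sumr.
by rewrite -[X in _ * X = _]/(adj (fun y => (y == i.2)%:R) x) adj_delta.
Qed.

Lemma dot_iter_adjm k m n : dot (iter k adjm m) n = dot m (iter k adjm n).
Proof.
by elim: k n => [//|k IH] n; rewrite iterS dot_adjm IH -iterSr.
Qed.

Lemma dot_catl m n k : dot (m ++ n) k = dot m k + dot n k.
Proof. exact: integ_cat. Qed.

Lemma dot_scalel a m k : dot [seq (a * i.1, i.2) | i <- m] k = a * dot m k.
Proof. exact: integ_scale. Qed.

(** The form is a sum of squares: group the list by vertices. *)
Lemma dot_ge0 m : 0 <= dot m m.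
Proof.
pose w y := integ m (fun z => (y == z)%:R).
pose s := undup [seq i.2 | i <- m].
suff -> : dot m m = \sum_(y <- s) w y ^+ 2.
  by apply: sumr_ge0 => y _; exact: sqr_ge0.
rewrite /dot -/w.
transitivity (\sum_(i <- m) \sum_(y <- s) w y * (i.1 * (y == i.2)%:R)).
  rewrite /integ big_seq [RHS]big_seq; apply: eq_bigr => i im.
  have si : i.2 \in s by rewrite mem_undup map_f.
  rewrite (bigD1_seq i.2) ?undup_uniq//= eqxx mulr1 big1 ?addr0 1?mulrC//.
  by move=> y /negbTE->; rewrite !mulr0.
rewrite exchange_big; apply: eq_bigr => y _.
by rewrite -mulr_sumr expr2.
Qed.

Lemma dot_CauchySchwarz m n : dot m n ^+ 2 <= dot m m * dot n n.
Proof.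
have H t : 0 <= dot m m + (t * dot m n) *+ 2 + t ^+ 2 * dot n n.
  have := dot_ge0 (m ++ [seq (t * i.1, i.2) | i <- n]).
  rewrite dot_catl dot_scalel [dot m _]dotC [dot n _]dotC !dot_catl !dot_scalel.
  by rewrite [dot n m]dotC; congr (0 <= _); ring.
have n0 := dot_ge0 n; move: n0; rewrite le_eqVlt => /orP[/eqP n0|n0].
  have [->|mn0] := eqVneq (dot m n) 0; first by rewrite expr0n /= -n0 mulr0.
  have := H (- (dot m m + 1) / (dot m n)); rewrite -n0 mulr0 addr0 divfK//.
  by have := dot_ge0 m; lra.
have := H (- dot m n / dot n n).
have -> : dot m m + (- dot m n / dot n n * dot m n) *+ 2
    + (- dot m n / dot n n) ^+ 2 * dot n n
  = (dot m m * dot n n - dot m n ^+ 2) / dot n n.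
  by field; rewrite gt_eqF.
by rewrite pmulr_lge0 ?invr_gt0// subr_ge0.
Qed.

Lemma expr_unbounded (a c : R) : 1 < a -> exists k, c < a ^+ k.
Proof.
move=> a1; have a10 : 0 < a - 1 by rewrite subr_gt0.
have B k : 1 + k%:R * (a - 1) <= a ^+ k.
  elim: k => [|k IH]; first by rewrite mul0r addr0 expr0.
  have k0 : 0 <= k%:R :> R by [].
  have : a * (1 + k%:R * (a - 1)) <= a ^+ k.+1.
    by rewrite exprS ler_wpM2l//; lra.
  apply: le_trans; rewrite -natr1 -subr_ge0.
  have -> : a * (1 + k%:R * (a - 1)) - (1 + (k%:R + 1) * (a - 1))
    = k%:R * (a - 1) ^+ 2 by ring.
  by rewrite mulr_ge0// sqr_ge0.
exists (Num.bound `|c / (a - 1)|); apply: lt_le_trans (B _).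
have : c / (a - 1) < (Num.bound `|c / (a - 1)|)%:R.
  by apply: le_lt_trans (ler_norm _) _; exact: archi_boundP.
by rewrite ltr_pdivrMr//; lra.
Qed.

Section Norm.
Variable r2 : R.
Hypothesis r20 : 0 <= r2.
Hypothesis growth : forall y z t, 0 < t -> r2 < t ^+ 2 ->
  exists2 C, 0 <= C & forall k, iter k (@adj R G) (fun x => (x == z)%:R) y <= C * t ^+ k.

Lemma sum_bound (I : Type) (s : seq I) (F : I -> nat -> R) (T : nat -> R) :
  (forall i, exists C, forall k, F i k <= C * T k) ->
  exists C, forall k, \sum_(i <- s) F i k <= C * T k.
Proof.
move=> H; elim: s => [|i s [C HC]].
  by exists 0 => k; rewrite big_nil mul0r.
have [D HD] := H i; exists (D + C) => k.
by rewrite big_cons mulrDl lerD.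
Qed.

Lemma growth_dot m t : 0 < t -> r2 < t ^+ 2 ->
  exists C, forall k, dot (iter k adjm m) (iter k adjm m) <= C * (t ^+ 2) ^+ k.
Proof.
move=> t0 rt.
have D k : dot (iter k adjm m) (iter k adjm m)
    = \sum_(i <- m) \sum_(j <- m)
        i.1 * (j.1 * iter (k + k) (@adj R G) (fun x => (x == j.2)%:R) i.2).
  rewrite dot_iter_adjm -iterD dotC [LHS]/dot integ_iter_adjm.
  apply: eq_bigr => i _; rewrite /integ iter_adj_sum mulr_sumr.
  by apply: eq_bigr => j _; rewrite iter_adjZ.
suff [C HC] : exists C, forall k, \sum_(i <- m) \sum_(j <- m)
    i.1 * (j.1 * iter (k + k) (@adj R G) (fun x => (x == j.2)%:R) i.2)
      <= C * (t ^+ 2) ^+ k.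
  by exists C => k; rewrite D.
apply: sum_bound => i; apply: sum_bound => j.
have [C C0 HC] := growth i.2 j.2 t0 rt.
exists (`|i.1 * j.1| * C) => k; rewrite mulrA -[in leRHS]mulrA -exprM mul2n -addnn.
set W := iter _ _ _ _; have W0 : 0 <= W.
  exact: iter_adj_ge0.
apply: le_trans (_ : `|i.1 * j.1| * W <= _); first by rewrite ler_wpM2r ?ler_norm.
by rewrite ler_wpM2l ?normr_ge0//; exact: HC.
Qed.

(** By Cauchy-Schwarz and symmetry, the squared norms of the iterated images of
    [m] form a log-convex sequence. If its first ratio exceeded [r2], it would
    grow geometrically at a rate above [r2], against [growth_dot]. *)
Lemma dot_adjm_le m : dot (adjm m) (adjm m) <= r2 * dot m m.
Proof.
pose a k := dot (iter k adjm m) (iter k adjm m).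
have a0 k : 0 <= a k by exact: dot_ge0.
have lc k : a k.+1 ^+ 2 <= a k * a k.+2.
  have -> : a k.+1 = dot (iter k adjm m) (iter k.+2 adjm m).
    by rewrite /a iterS dot_adjm.
  exact: dot_CauchySchwarz.
rewrite -[leLHS]/(a 1%N) -[dot m m]/(a 0%N) leNgt; apply/negP => H.
have a1 : 0 < a 1%N by apply: le_lt_trans H; rewrite mulr_ge0.
have a00 : 0 < a 0%N.
  rewrite lt_neqAle a0 andbT; apply/eqP => E; have := lc 0%N.
  by rewrite -E mul0r lt_geF// exprn_gt0.
have [th thE] : exists t, t = a 1%N / a 0%N by eexists.
have th0 : r2 < th by rewrite thE ltr_pdivlMr.
have G1 k : 0 < a k /\ th * a k <= a k.+1.
  elim: k => [|k [ak thk]]; first by rewrite thE divfK// gt_eqF.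
  have ak1 : 0 < a k.+1.
    by apply: lt_le_trans thk; rewrite mulr_gt0// thE divr_gt0.
  split=> //; rewrite -(ler_pM2l ak); apply: le_trans (lc k).
  by rewrite expr2 mulrA [a k * th]mulrC ler_wpM2r// ltW.
have G2 k : th ^+ k * a 0%N <= a k.
  elim: k => [|k IH]; first by rewrite mul1r.
  apply: le_trans (G1 k).2; rewrite exprS -mulrA ler_wpM2l//.
  by rewrite thE divr_ge0.
pose s := (r2 + th) / 2.
have th00 : 0 < th := le_lt_trans r20 th0.
have s0 : 0 < s by rewrite /s divr_gt0// ltr_wpDl.
have [||C HC] := @growth_dot m (Num.sqrt s); rewrite ?sqrtr_gt0 ?sqr_sqrtr ?(ltW s0)//.
  by rewrite /s; lra.
have [|k] := @expr_unbounded (th / s) (C / a 0%N).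
  by rewrite ltr_pdivlMr// mul1r /s; lra.
rewrite ltr_pdivrMr// expr_div_n mulrAC ltr_pdivlMr ?exprn_gt0// ltNge.
move/negP; apply; apply: le_trans (G2 k) _.
by have := HC k; rewrite sqr_sqrtr// ltW.
Qed.

End Norm.
End Measures.

(** * Collisions of nonbacktracking walks *)

Section Spheres.
Variables (R : realType) (G : multigraph) (d : nat).
Hypothesis reg : regular G d.
Hypothesis d2 : (1 < d)%N.
Hypothesis norm_le : forall m : seq (R * vertex G),
  dot (adjm m) (adjm m) <= 4 * d.-1%:R * dot m m.
Implicit Types (x y z : vertex G) (e : oedge G) (u v : vertex G -> R) (m n : seq (R * vertex G)).
Local Notation q := (d.-1%:R : R).

Definition nbend k x : seq (R * vertex G) :=
  [seq (1, head (last e p)) | e <- out x, p <- nbcont k e].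

Lemma integ_nbend k x u : integ (nbend k x) u = nbwalk_sum k.+1 u x.
Proof.
rewrite /integ big_allpairs_dep /=; apply: eq_bigr => e _.
by rewrite iter_nbsum_nbcont; apply: eq_bigr => p _; rewrite mul1r.
Qed.

Lemma integ_nbend_ge k e u : (forall y, 0 <= u y) ->
  \sum_(p <- nbcont k e) u (head (last e p)) <= integ (nbend k (tail e)) u.
Proof.
move=> u0; rewrite integ_nbend /= (bigD1_seq e) ?out_uniq ?mem_out//=.
rewrite iter_nbsum_nbcont lerDl; apply: sumr_ge0 => f _.
by rewrite iter_nbsum_nbcont sumr_ge0// => p _; exact: u0.
Qed.

Lemma integ_nbend_ge0 k x u : (forall y, 0 <= u y) -> 0 <= integ (nbend k x) u.
Proof.
move=> u0; rewrite integ_nbend -(mulr0 (d%:R * d.-1%:R ^+ k)).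
by rewrite -(nbwalk_sum_cst reg k 0 x) nbwalk_sum_le.
Qed.

Lemma dot_nbend k x m :
  dot (nbend k.+2 x) m = dot (adjm (nbend k.+1 x)) m - q * dot (nbend k x) m.
Proof.
by rewrite /dot integ_adjm !integ_nbend (nbwalk_sum_adj reg) addrK.
Qed.

Let q1 : 1 <= q.
Proof. by rewrite ler1n -ltnS prednK// ltnW. Qed.

Let q0 : 0 < q. Proof. exact: lt_le_trans q1. Qed.

(** The crude bound by the number of pairs of walks; it serves for the first two
    norms, where it does not depend on the vertex. *)
Lemma dot_nbend_le k x : dot (nbend k x) (nbend k x) <= (d%:R * q ^+ k) ^+ 2.
Proof.
have le1 y : integ (nbend k x) (fun z => (y == z)%:R) <= d%:R * q ^+ k.
  rewrite -[leRHS]mulr1 -(nbwalk_sum_cst reg k 1 x) integ_nbend.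
  by apply: nbwalk_sum_le => z; case: eqP.
rewrite /dot integ_nbend; apply: le_trans (nbwalk_sum_le _ _ le1) _.
by rewrite (nbwalk_sum_cst reg) expr2.
Qed.

Section Energy.
Variable x : vertex G.

Let a k := dot (nbend k x) (nbend k x).
Let o k := dot (adjm (nbend k.+1 x)) (nbend k x).
Let s k := Num.sqrt (a k / q ^+ k.+1).

(** With [f_k] for [q ^ (- (k + 1) / 2)] times [nbend k x], the recursion
    [dot_nbend] reads [f_(k+2) = A f_(k+1) / sqrt q - f_k]. This is
    the quadratic form conserved by such a recursion,
    [|f_(k+1)|^2 + |f_k|^2 - <A f_(k+1), f_k> / sqrt q]. *)
Definition energy k := a k.+1 / q ^+ k.+2 + a k / q ^+ k.+1 - o k / q ^+ k.+2.

Lemma energyS k : energy k.+1 = energy k.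
Proof.
have E : a k.+2 - o k.+1 = - q * (o k - q * a k).
  have -> : o k.+1 = dot (adjm (nbend k.+1 x)) (nbend k.+2 x).
    by rewrite /o dot_adjm dotC.
  have -> : o k - q * a k = dot (nbend k x) (nbend k.+2 x).
    by rewrite [RHS]dotC dot_nbend.
  by rewrite {1}/a dot_nbend; ring.
rewrite /energy.
have -> : a k.+2 = - q * (o k - q * a k) + o k.+1 by rewrite -E subrK.
by rewrite !exprS; field; rewrite !gt_eqF// exprn_gt0.
Qed.

Let a0 k : 0 <= a k. Proof. exact: dot_ge0. Qed.

Let sE k : s k ^+ 2 = a k / q ^+ k.+1.
Proof. by rewrite sqr_sqrtr// divr_ge0// exprn_ge0// ltW. Qed.

Let s0 k : 0 <= s k. Proof. exact: sqrtr_ge0. Qed.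

(** This is where the norm bound enters: the operator [A / sqrt q] has norm at
    most two. *)
Lemma cross_le k : `|o k / q ^+ k.+2| <= 2 * s k.+1 * s k.
Proof.
have qk : 0 < q ^+ k.+2 by rewrite exprn_gt0.
rewrite -(@ler_pXn2r _ 2) ?nnegrE ?mulr_ge0// real_normK ?num_real//.
rewrite !exprMn !sE exprVn.
have H := le_trans (dot_CauchySchwarz _ _) (ler_wpM2r (a0 k) (norm_le (nbend k.+1 x))).
rewrite -/(o k) -/(a k.+1) in H.
have -> : 2 ^+ 2 * (a k.+1 / q ^+ k.+2) * (a k / q ^+ k.+1)
   = (4 * q * a k.+1 * a k) / (q ^+ k.+2) ^+ 2.
  by rewrite [q ^+ k.+2]exprS; field; rewrite !gt_eqF// exprn_gt0.
by rewrite ler_wpM2r// invr_ge0 exprn_ge0// ltW.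
Qed.

Lemma energy_ge k : (s k.+1 - s k) ^+ 2 <= energy k.
Proof.
rewrite /energy -!sE; have := cross_le k; rewrite ler_norml => /andP[_].
by rewrite sqrrB; lra.
Qed.

Lemma energy_le : energy 0 <= (s 1 + s 0) ^+ 2.
Proof.
rewrite /energy -!sE; have := cross_le 0; rewrite ler_norml => /andP[+ _].
by rewrite sqrrD; lra.
Qed.

(** The conserved energy dominates the squared increment of the norm [s], so the
    increments are bounded and [s] grows at most linearly. *)
Lemma norm_incr k : s k.+1 <= s k + (s 1 + s 0).
Proof.
have E : energy k = energy 0 by elim: k => [//|k IH]; rewrite energyS.
have := le_trans (energy_ge k) _; rewrite E => /(_ _ energy_le).
rewrite -ler_sqrt ?exprn_ge0 ?addr_ge0// !sqrtr_sqr [in leRHS]ger0_norm ?addr_ge0//.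
by move=> /(le_trans (ler_norm _)); lra.
Qed.

Lemma norm_linear k : s k <= k.+1%:R * (s 1 + s 0).
Proof.
elim: k => [|k IH]; first by rewrite mul1r lerDr.
by apply: le_trans (norm_incr k) _; rewrite -[k.+2%:R]natr1 mulrDl mul1r lerD2r.
Qed.

Lemma norm_01 : s 1 + s 0 <= 2 * d%:R.
Proof.
have H k : (k <= 1)%N -> s k <= d%:R.
  move=> k1; rewrite -[leRHS]ger0_norm// -sqrtr_sqr ler_sqrt ?exprn_ge0//.
  rewrite ler_pdivrMr ?exprn_gt0//; apply: le_trans (dot_nbend_le _ _) _.
  rewrite exprMn ler_wpM2l ?exprn_ge0// -exprM ler_weXn2l//; lia.
by rewrite mulr_natl mulr2n lerD// H.
Qed.

Lemma nbend_norm k :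
  dot (nbend k x) (nbend k x) <= (2 * d%:R * k.+1%:R) ^+ 2 * q ^+ k.+1.
Proof.
rewrite -ler_pdivrMr ?exprn_gt0// -/(a k) -sE ler_pXn2r ?nnegrE ?mulr_ge0//.
by apply: le_trans (norm_linear k) _; rewrite mulrC ler_wpM2r// norm_01.
Qed.

Lemma nbend_cross k l : (l <= k)%N ->
  dot (nbend k x) (nbend l x) <= (2 * d%:R * k.+1%:R) ^+ 2 * q ^+ k.+1.
Proof.
move=> lk; set b := leRHS.
have b0 : 0 <= b by rewrite mulr_ge0 ?exprn_ge0// ltW.
apply: le_trans (ler_norm _) _.
rewrite -(@ler_pXn2r _ 2) ?nnegrE// real_normK ?num_real//.
apply: le_trans (dot_CauchySchwarz _ _) _; rewrite expr2.
apply: ler_pM; rewrite ?dot_ge0//; first exact: nbend_norm.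
apply: le_trans (nbend_norm l) _; rewrite /b.
apply: ler_pM; rewrite ?exprn_ge0 ?(ltW q0)//.
  by rewrite ler_pXn2r ?nnegrE ?mulr_ge0// ler_wpM2l ?mulr_ge0// ler_nat.
by rewrite ler_weXn2l.
Qed.

End Energy.

Section Pairs.
Variable B : nat.
Variables (E : pred (oedge G)) (a b : oedge G -> seq (oedge G)).
Hypothesis Eab : forall e, E e -> switch B e (a e, b e).

(** The pairs are distinct, and both walks of a pair end at the same vertex. *)
Lemma size_pairs_le M e : (size (pairs B E a b M e))%:R <=
  \sum_(j < (M * B).+1) dot (nbend (M * B) (tail e)) (nbend j (tail e)).
Proof.
set n := (M * B)%N.
pose T j := [seq u <- [seq (p, p') | p <- nbcont n e, p' <- nbcont j e] |
             head (last e u.1) == head (last e u.2)].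
have sub : (size (pairs B E a b M e) <= size (flatten [seq T j | j <- iota 0 n.+1]))%N.
  apply: uniq_leq_size; first exact: (pairs_uniq Eab).
  move=> u /(mem_pairs Eab)[p1 p2 s1 s2 l12].
  apply/flatten_mapP; exists (size u.2); first by rewrite mem_iota.
  rewrite mem_filter l12 eqxx; apply/allpairsP; exists u.
  by rewrite !mem_nbcont s1 !eqxx p1 p2; split=> //; case: (u).
apply: le_trans (_ : (size (flatten [seq T j | j <- iota 0 n.+1]))%:R <= _).
  by rewrite ler_nat.
rewrite size_flatten /shape -map_comp sumnE big_map natr_sum.
rewrite -[iota 0 n.+1]/(index_iota 0 n.+1) big_mkord; apply: ler_sum => j _ /=.
rewrite size_filter -sum1_count big_mkcond big_allpairs_dep natr_sum /=.
apply: le_trans (integ_nbend_ge _ _ _) => [|y]; last first.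
  exact: integ_nbend_ge0.
apply: ler_sum => p _; rewrite natr_sum.
apply: le_trans (integ_nbend_ge j e (u := fun z => (head (last e p) == z)%:R) _) => //.
Qed.

Lemma npairs_le M e : npairs R d B E a b M e
  <= 4 * d%:R ^+ 2 * q * (M * B).+1%:R ^+ 3.
Proof.
set n := (M * B)%N; rewrite /npairs ler_pdivrMl ?exprn_gt0//.
apply: le_trans (size_pairs_le _ _) _.
apply: le_trans (_ : \sum_(j < n.+1) (2 * d%:R * n.+1%:R) ^+ 2 * q ^+ n.+1 <= _).
  by apply: ler_sum => j _; apply: nbend_cross; rewrite -ltnS.
rewrite sumr_const card_ord -[_ *+ _]mulr_natr [q ^+ n.+1]exprS.
by rewrite le_eqVlt; apply/orP; left; apply/eqP; ring.
Qed.

End Pairs.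
End Spheres.

(** * Short cycles are rarely visited without backtracking *)

Lemma exp_beats_cube (R : realType) (B : nat) (C Q eps : R) :
  0 <= C -> 0 <= Q -> 0 < eps ->
  exists M T : nat, (0 < M)%N /\
    Q * (T%:R + (2 ^+ T)^-1 * (C * (M * B).+1%:R ^+ 3)) <= eps * M%:R.
Proof.
move=> C0 Q0 e0.
have [m [m0 Hm]] : exists m : nat, (0 < m)%N /\ 2 * Q / eps <= m%:R.
  set K := 2 * Q / eps; have K0 : 0 <= K by rewrite divr_ge0 ?mulr_ge0// ltW.
  by exists (Num.bound K).+1; split=> //; apply: le_trans (ltW (archi_boundP K0)) _; rewrite ler_nat.
have [n [n0 Hn]] : exists n : nat, (0 < n)%N /\ C * (4 * m * B).+1%:R ^+ 3 <= n%:R.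
  set K := C * _; have K0 : 0 <= K by rewrite mulr_ge0.
  by exists (Num.bound K).+1; split=> //; apply: le_trans (ltW (archi_boundP K0)) _; rewrite ler_nat.
have nR : 1 <= n%:R :> R by rewrite ler1n.
(* with this choice [2 ^ T >= n ^ 4], against a cube of [n] *)
exists (4 * m * n)%N, (4 * n)%N; split; first by rewrite !muln_gt0 m0 n0.
have P : (2 ^+ (4 * n))^-1 * (C * (4 * m * n * B).+1%:R ^+ 3) <= 1 :> R.
  rewrite mulrC ler_pdivrMr ?exprn_gt0// mul1r.
  have H1 : (4 * m * n * B).+1%:R <= n%:R * (4 * m * B).+1%:R :> R.
    by rewrite -natrM ler_nat; nia.
  apply: le_trans (_ : C * (n%:R * (4 * m * B).+1%:R) ^+ 3 <= _).
    by rewrite ler_wpM2l// ler_pXn2r ?nnegrE ?mulr_ge0.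
  rewrite exprMn mulrCA; apply: le_trans (_ : n%:R ^+ 3 * n%:R <= _).
    by rewrite ler_wpM2l ?exprn_ge0.
  rewrite -exprSr mulnC exprM ler_pXn2r ?nnegrE ?exprn_ge0// -natrX ler_nat.
  by apply/ltnW/ltn_expl.
apply: le_trans (_ : Q * (5 * n%:R) <= _).
  by rewrite ler_wpM2l// natrM; lra.
rewrite !natrM; move: Hm; rewrite ler_pdivrMr// => Hm.
have := ler_wpM2r (ler0n R n) Hm; have := mulr_ge0 Q0 (ler0n R n); lra.
Qed.

Section Cesaro.
Variables (R : realType) (G : multigraph) (d : nat).
Hypothesis reg : regular G d.
Hypothesis d3 : (2 < d)%N.
Hypothesis norm_le : forall m : seq (R * vertex G),
  dot (adjm m) (adjm m) <= 4 * d.-1%:R * dot m m.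
Variable L : nat.
Local Notation q := (d.-1%:R : R).
Local Notation B := (L.*2.+2).*2.

Definition short_ind (x : vertex G) : R := (`[< on_short_cycle L x >])%:R.

(** At block times, a walk that reaches a short cycle [L.*2.+1] steps later is at
    a switchable edge, and by [visits_le_npairs] and [npairs_le] the expected
    number of such times is at most logarithmic in the number of blocks, uniformly
    in the starting point. The times [k.+1] that are averaged over are even
    because the decay argument for simple random walk respects parity. *)
Lemma nb_cesaro (eps : R) : 0 < eps -> exists s : seq nat,
  [/\ s != [::], forall k, k \in s -> odd k &
   forall x, \sum_(k <- s) (d%:R * q ^+ k)^-1 * nbwalk_sum k.+1 short_ind x
     <= eps * (size s)%:R].
Proof.
move=> eps0.
pose E (e : oedge G) : bool := `[< exists ab, switch B e ab >].
have /choice[ab Hab] : forall e, exists ab, E e -> switch B e ab.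
  move=> e.
  have [Ee|nEe] := boolP (E e); last by exists ([::], [::]).
  by have /asboolP[ab] := Ee; exists ab.
have Eab e : E e -> switch B e ((fst \o ab) e, (snd \o ab) e).
  by move=> /Hab; rewrite /=; case: (ab e).
have q0 : 0 < q by rewrite ltr0n; lia.
have d0 : 0 < d%:R :> R by rewrite ltr0n; lia.
have [M [T [M0 HMT]]] := @exp_beats_cube R B (4 * d%:R ^+ 2 * q) (q ^+ B) eps
  (mulr_ge0 (mulr_ge0 (ler0n _ 4) (exprn_ge0 2 (ler0n R d))) (ltW q0)) (exprn_ge0 B (ltW q0)) eps0.
have V e : visits R d B E M e <= eps * M%:R.
  have := visits_le_npairs R reg (ltnW d3) Eab M T e.
  rewrite ler_pdivrMl ?exprn_gt0// => H; apply: le_trans H _.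
  apply: le_trans HMT; rewrite ler_wpM2l ?exprn_ge0 ?(ltW q0)//.
  rewrite lerD2l ler_wpM2l ?invr_ge0 ?exprn_ge0//.
  exact: (npairs_le reg (ltnW d3) norm_le Eab).
exists [seq (L.*2.+1 + i * B)%N | i <- iota 0 M]; split.
- by case: (M) M0.
- move=> k /mapP[i _ ->]; rewrite oddD /= odd_double /=.
  by rewrite oddM odd_double andbF.
move=> x; rewrite size_map size_iota big_map.
have -> : iota 0 M = index_iota 0 M by rewrite /index_iota subn0.
rewrite big_mkord.
have W e i : iter (L.*2.+1 + i * B) (@nbsum R G) (short_ind \o @head G) e
    <= q ^+ L.*2.+1 * iter (i * B) (@nbsum R G) (fun f => (E f)%:R) e.
  rewrite addnC iterD -iter_nbsumZ; apply: iter_nbsum_le => f.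
  have [Ef|nEf] := boolP (E f).
    rewrite -(iter_nbsum_cst reg _ (1 : R) f).
    by apply: iter_nbsum_le => g; rewrite /= /short_ind; case: asbool.
  rewrite mulr0 iter_nbsum_nbcont big_seq big1// => p.
  rewrite mem_nbcont => /andP[/eqP sp pp]; rewrite /= /short_ind.
  case: asboolP => // osc; move/negP: nEf; case.
  by apply/asboolP; apply: short_cycle_switch osc.
have qn n : 0 < q ^+ n by rewrite exprn_gt0.
apply: le_trans (_ : \sum_(e <- out x) d%:R^-1 * visits R d B E M e <= _).
  rewrite /visits; under [leRHS]eq_bigr do rewrite mulr_sumr.
  rewrite exchange_big; apply: ler_sum => i _.
  rewrite /= mulr_sumr; apply: ler_sum => e _.
  rewrite exprD !invfM -!mulrA ler_wpM2l ?invr_ge0 ?(ltW d0)//.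
  rewrite mulrCA ler_wpM2l ?invr_ge0 ?(ltW (qn _))//.
  by rewrite ler_pdivrMl//; exact: W.
rewrite -mulr_sumr ler_pdivrMl//.
apply: le_trans (_ : \sum_(e <- out x) eps * M%:R <= _); first exact: ler_sum.
by rewrite big_const_seq count_predT iter_addr_0 -/(deg x) reg mulr_natl.
Qed.

End Cesaro.

(** * Degree at most two *)

Lemma no_closed_seq (G : multigraph) (C : seq (vertex G)) x :
  infinite_graph G -> connected_graph G -> x \in C ->
  (forall e, tail e \in C -> head e \in C) -> False.
Proof.
move=> inf conn xC cl; apply: inf; apply: sub_finite_set (finite_seq C) => y _ /=.
have [<-//|[e [p [pp te <-]]]] := conn x y.
rewrite -te in xC => {te}; elim: p e pp xC => [|f p IH] e /= pp eC; first exact: cl.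
by move: pp => /andP[/eqP ef pp]; apply: IH pp _; rewrite -ef; exact: cl.
Qed.

Section Line.
Variables (R : realType) (G : multigraph).
Hypothesis reg : regular G 2.
Hypothesis inf : infinite_graph G.
Hypothesis conn : connected_graph G.
Variable L : nat.
Implicit Types (e f : oedge G) (x : vertex G).

Definition succ_edge e : oedge G := seq.head e (nbnext e).
Local Notation nx := succ_edge.

Lemma nbnextE e : nbnext e = [:: nx e].
Proof.
rewrite /nx; have := size_nbnext e reg.
by case: (nbnext e) => [//|f [|]].
Qed.

Lemma nbstep_succ e f : nbstep e f = (f == nx e).
Proof. by rewrite /nbstep nbnextE inE. Qed.

Lemma path_succ e p : path nbstep e p -> last e p = iter (size p) nx e.
Proof.
elim: p e => [//|f p IH] e /=; rewrite nbstep_succ => /andP[/eqP-> /IH->].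
by rewrite -iterSr.
Qed.

Lemma path_succ_inj e p p' : path nbstep e p -> path nbstep e p' ->
  size p = size p' -> p = p'.
Proof.
elim: p p' e => [|f p IH] [|f' p'] e //=.
rewrite !nbstep_succ => /andP[/eqP-> pp] /andP[/eqP-> pp'] [s].
by rewrite (IH _ _ pp pp').
Qed.

Lemma flip_succ e : nx (flip (nx e)) = flip e.
Proof.
have : nbstep e (nx e) by rewrite nbstep_succ.
by move=> /nbstep_flip; rewrite nbstep_succ => /eqP.
Qed.

Lemma succ_inj : injective nx.
Proof.
by move=> e f ef; apply: (can_inj (@flipK G)); rewrite -(flip_succ e) ef flip_succ.
Qed.

Lemma iter_succ_flip k e : iter k nx (flip (iter k nx e)) = flip e.
Proof. by elim: k => [//|k IH]; rewrite iterSr iterS flip_succ. Qed.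

Lemma out_head_cases e f : tail f = head e -> f = flip e \/ f = nx e.
Proof.
move=> tf; have : f \in out (head e) by rewrite mem_out tf.
have [->|nf] := eqVneq f (flip e); first by left.
by move=> fo; right; apply/eqP; rewrite -nbstep_succ nbstepE nf tf eqxx.
Qed.

(** In degree two a periodic trajectory meets all edges at its vertices, so it
    would sweep out a finite graph. *)
Lemma succ_aperiodic k e : iter k.+1 nx e <> e.
Proof.
move=> per; pose C := [seq head (iter i nx e) | i <- iota 0 k.+1].
have Cn i : head (iter i nx e) \in C.
  have P n : iter (n * k.+1) nx e = e.
    by elim: n => [//|n IH]; rewrite mulSn iterD IH.
  rewrite (divn_eq i k.+1) addnC iterD P.
  by apply/mapP; exists (i %% k.+1)%N; rewrite ?mem_iota ?ltn_mod.
apply: (no_closed_seq inf conn (Cn 0)) => f /mapP[i _ tf].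
have [->|->] := out_head_cases tf; last exact: (Cn i.+1).
rewrite head_flip.
have -> : iter i nx e = nx (iter (i + k) nx e).
  by rewrite -iterS -addnS iterD per.
have : nbstep (iter (i + k) nx e) (nx (iter (i + k) nx e)) by rewrite nbstep_succ.
by move=> /nbstep_tail->; exact: Cn.
Qed.

Lemma iter_succ_inj e : injective (fun i => iter i nx e).
Proof.
move=> i j /=; wlog ij : i j / (i <= j)%N.
  by move=> W H; have [/W->|/ltnW/W->] := leqP i j.
rewrite -(subnK ij) addnC iterD; move: (j - i)%N => k {j ij} H.
have inji : injective (iter i nx) by elim: i {H} => [|i IH] ? ? //= /succ_inj/IH.
case: k H => [|k]; first by rewrite addn0.
by move=> /inji /esym /succ_aperiodic.
Qed.

Definition turns e t : Prop := iter t nx e = flip e.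

(** The two colliding routes are initial segments of the same trajectory. At
    their common end the trajectory cannot leave twice in the same direction, by
    aperiodicity, so it arrives the second time along the reversal of the edge by
    which it left the first time, and then retraces its steps. *)
Lemma short_cycle_turns e w : path nbstep e w -> size w = L.*2.+1 ->
  on_short_cycle L (head (last e w)) ->
  exists2 t, (t <= (L.*2.+1).*2.*2)%N & turns e t.
Proof.
move=> pw sw osc.
have [|a [b [pa pb nab hab [sa sb]]]] := short_cycle_collision pw _ osc.
  by rewrite sw.
move: hab; rewrite (path_succ pa) (path_succ pb).
have : size a <> size b by move=> /(path_succ_inj pa pb).
move: (size a) (size b) sa sb; rewrite sw => {a b pa pb nab} i j si sj nij hij.
have tf : tail (flip (iter i nx e)) = head (iter j nx e).
  by rewrite tail_flip.
have [/(can_inj (@flipK G))/iter_succ_inj//|E] := out_head_cases tf.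
exists (i + j.+1)%N; first by lia.
by rewrite /turns iterD iterS -E iter_succ_flip.
Qed.

(** The place where the trajectory of [e] returns as [flip e] is unique, and a
    turn at its [k]-th edge forces this place to be [k + k + t]. *)
Lemma turns_unique e k k' t t' :
  turns (iter k nx e) t -> turns (iter k' nx e) t' -> (k + k + t = k' + k' + t')%N.
Proof.
have P j s : turns (iter j nx e) s -> iter (j + j + s) nx e = flip e.
  move=> E; have -> : (j + j + s = j + (s + j))%N by lia.
  by rewrite iterD [iter (s + j) _ _]iterD E iter_succ_flip.
by move=> /P H /P; rewrite -H => /iter_succ_inj.
Qed.


Lemma iter_nbsum_succ k (phi : oedge G -> R) e :
  iter k (@nbsum R G) phi e = phi (iter k nx e).
Proof.
by elim: k e => [//|k IH] e; rewrite iterS /nbsum nbnextE big_seq1 IH -iterSr.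
Qed.

(** By [turns_unique], the visits all have their index in a window of fixed
    length. *)
Lemma line_visits M e :
  (\sum_(i < M)
    `[< on_short_cycle L (head (iter (L.*2.+1 + i * 2) nx e)) >]
     <= ((L.*2.+1).*2.*2).+1)%N.
Proof.
set K := (L.*2.+1).*2.*2.
pose P (i : nat) := `[< on_short_cycle L (head (iter (L.*2.+1 + i * 2) nx e)) >].
have T i : P i -> exists2 t, (t <= K)%N & turns (iter (i * 2) nx e) t.
  move=> /asboolP; rewrite iterD.
  have [w pw sw] := nb_extend reg L.*2.+1 (iter (i * 2) nx e) isT.
  by rewrite -sw -(path_succ pw); exact: short_cycle_turns.
rewrite -(big_mkord predT (fun i => nat_of_bool (P i))).
have -> : (\sum_(0 <= i < M) P i = size [seq i <- index_iota 0 M | P i])%N.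
  rewrite size_filter -sum1_count [RHS]big_mkcond.
  by apply: eq_bigr => i _; case: (P i).
case E : [seq i <- index_iota 0 M | P i] => [//|i0 r]; rewrite -E.
have : i0 \in [seq i <- index_iota 0 M | P i] by rewrite E mem_head.
rewrite mem_filter => /andP[/T[t0 t0K T0] _].
rewrite -(size_map (fun i => i * 4)%N) -(size_iota (i0 * 4 + t0 - K) K.+1).
apply: uniq_leq_size.
  rewrite map_inj_uniq; last by move=> i j; lia.
  by apply: filter_uniq; exact: iota_uniq.
move=> _ /mapP[i + ->]; rewrite mem_filter => /andP[/T[t tK Tt] _].
by have := turns_unique T0 Tt; rewrite mem_iota; lia.
Qed.

Lemma line_cesaro (eps : R) : 0 < eps -> exists s : seq nat,
  [/\ s != [::], forall k, k \in s -> odd k &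
   forall x, \sum_(k <- s)
      (2%:R * 2.-1%:R ^+ k)^-1 * nbwalk_sum k.+1 (@short_ind R G L) x
     <= eps * (size s)%:R].
Proof.
move=> eps0; set K := ((L.*2.+1).*2.*2).+1.
have [M [M0 HM]] : exists M : nat, (0 < M)%N /\ K%:R <= eps * M%:R.
  have K0 : 0 <= K%:R / eps by rewrite divr_ge0// ltW.
  exists (Num.bound (K%:R / eps)).+1; split=> //.
  rewrite mulrC -ler_pdivrMr//; apply: le_trans (ltW (archi_boundP K0)) _.
  by rewrite ler_nat.
exists [seq (L.*2.+1 + i * 2)%N | i <- iota 0 M]; split.
- by case: (M) M0.
- by move=> k /mapP[i _ ->]; rewrite oddD /= odd_double oddM andbF.
move=> x; rewrite size_map size_iota big_map.
have -> : iota 0 M = index_iota 0 M by rewrite /index_iota subn0.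
rewrite big_mkord.
have F k : (2%:R * 2.-1%:R ^+ k)^-1 * nbwalk_sum k.+1 (@short_ind R G L) x
    = \sum_(e <- out x) 2^-1 * short_ind R L (head (iter k nx e)).
  rewrite /nbwalk_sum expr1n mulr1 mulr_sumr; apply: eq_bigr => e _.
  by rewrite iter_nbsum_succ.
under eq_bigr do rewrite F.
rewrite exchange_big.
apply: le_trans (_ : \sum_(e <- out x) 2^-1 * (eps * M%:R) <= _).
  apply: ler_sum => e _; rewrite -mulr_sumr ler_wpM2l ?invr_ge0//.
  apply: le_trans HM; apply: le_trans (_ : (\sum_(i < M)
    `[< on_short_cycle L (head (iter (L.*2.+1 + i * 2) nx e)) >])%N%:R <= _).
    by rewrite natr_sum; apply: ler_sum.
  by rewrite ler_nat line_visits.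
rewrite big_const_seq count_predT iter_addr_0 -/(deg x) reg.
by set X := eps * _; rewrite mulr2n; lra.
Qed.

End Line.

Lemma degree_gt1 (G : multigraph) d : infinite_graph G -> connected_graph G ->
  regular G d -> (1 < d)%N.
Proof.
move=> inf conn reg; rewrite ltnNge; apply/negP => d1.
have [x _] := infinite_setN0 inf.
have mo (e : oedge G) y : tail e = y -> e \in out y by move=> <-; rewrite mem_out.
case ox : (out x) => [|e r].
  apply: (@no_closed_seq G [:: x] x) => //; first exact: mem_head.
  by move=> f; rewrite inE => /eqP /mo; rewrite ox.
have ex : tail e = x by apply/eqP; rewrite -mem_out ox mem_head.
have U (y : vertex G) f g : tail f = y -> tail g = y -> f = g.
  move=> /mo + /mo; have := reg y; rewrite /deg.
  case: (out y) => [//|h [|h' s]] /=; last by move=> ? ? ?; lia.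
  by move=> _; rewrite !inE => /eqP-> /eqP->.
apply: (@no_closed_seq G [:: x; head e] x) => //; first exact: mem_head.
move=> f; rewrite !inE => /orP[/eqP tf|/eqP tf].
  by rewrite (U _ _ _ tf ex) eqxx orbT.
by rewrite (U _ _ (flip e) tf) ?tail_flip// head_flip ex eqxx.
Qed.

(** * From the spectral radius to the growth of walk counts *)

Section Spectral.
Variables (R : realType) (G : multigraph) (d : nat).
Hypothesis reg : regular G d.
Hypothesis d0 : (0 < d)%N.
Implicit Types (x y z : vertex G) (e : oedge G).
Local Notation adj := (@adj R G).

Lemma srw_prob_adj (P : vertex G -> Prop) n x :
  srw_prob R n x (fun p => P (position x p))
  = (d%:R ^+ n)^-1 * iter n adj (fun y => `[< P y >]%:R) x.
Proof.
rewrite /srw_prob; elim: n x => [|n IH] x.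
  rewrite expr0 invr1 mul1r big_cons big_nil /= /position /= big_nil addr0.
  by case: asboolP.
rewrite big_mkcond /= big_allpairs_dep /= /adj exprS invfM mulr_sumr.
rewrite big_seq [RHS]big_seq; apply: eq_bigr => e; rewrite mem_out => /eqP te.
rewrite -mulrA -IH [in RHS]big_mkcond mulr_sumr; apply: eq_bigr => p _.
rewrite -[position x (e :: p)]/(position (head e) p).
case: ifP => _; last by rewrite mulr0.
by rewrite big_cons te reg.
Qed.

Lemma adj_ge u x e : (forall y, 0 <= u y) -> tail e = x -> u (head e) <= adj u x.
Proof.
move=> u0 te; rewrite /adj (bigD1_seq e) ?out_uniq ?mem_out ?te//= lerDl.
exact: sumr_ge0.
Qed.

Lemma adj_reach x y : connected_graph G ->
  exists a, 1 <= iter a adj (fun w => (w == y)%:R) x.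
Proof.
move=> /(_ x y)[->|[e [p [pp <- <-]]]]; first by exists 0%N; rewrite /= eqxx.
exists (size p).+1; elim: p e pp => [|f p IH] e /=.
  move=> _; apply: le_trans (adj_ge _ (erefl (tail e))) => //=.
  by rewrite eqxx.
move=> /andP[/eqP ef pp]; apply: le_trans (IH f pp) _; rewrite -ef.
by apply: adj_ge => // w; exact: (iter_adj_ge0 (size p).+1).
Qed.

(** Walks from [y] to [z] are completed to closed walks at [o] by fixed walks
    from [o] to [y] and from [z] to [o], and the closed walks at [o] are counted
    by the return probabilities. *)
Lemma growth_bound (o : vertex G) : connected_graph G ->
  spectral_radius R o = (2 * Num.sqrt (d%:R - 1) / d%:R)%:E ->
  forall y z t, 0 < t -> 4 * d.-1%:R < t ^+ 2 ->
  exists2 C, 0 <= C & forall k, iter k adj (fun x => (x == z)%:R) y <= C * t ^+ k.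
Proof.
move=> conn rho y z t t0 qt.
have dR : 0 < d%:R :> R by rewrite ltr0n.
have lt_t : 2 * Num.sqrt (d%:R - 1) / d%:R < t / d%:R.
  rewrite ltr_pM2r ?invr_gt0// -(@ltr_pXn2r _ 2) ?nnegrE ?(ltW t0) ?mulr_ge0 ?sqrtr_ge0//.
  have -> : d%:R - 1 = d.-1%:R :> R by rewrite -subn1 natrB.
  by rewrite exprMn sqr_sqrtr// -natrX.
have [K HK] : exists K, forall k, (K <= k)%N ->
    iter k adj (fun x => (x == o)%:R) o <= t ^+ k.
  have : (spectral_radius R o < (t / d%:R)%:E)%E by rewrite rho lte_fin.
  rewrite /spectral_radius /limn_esup /limf_esup => /ereal_inf_lt[_ [V [N _ NV] <-]] H.
  exists N.+1 => k Nk.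
  have kV : V k by apply: NV => /=; exact: ltnW.
  have := le_lt_trans (ereal_sup_ubound (imageP _ kV)) H.
  rewrite lte_fin => /ltW {}H.
  have tp : trans_prob R k o o = (d%:R ^+ k)^-1 * iter k adj (fun x => (x == o)%:R) o.
    rewrite /trans_prob (srw_prob_adj (fun y => y = o)); congr (_ * _); apply: iter_adj_ext => x.
    by case: asboolP => [->|ne]; [rewrite eqxx | case: eqP].
  have tp0 : 0 <= trans_prob R k o o.
    by rewrite tp mulr_ge0 ?invr_ge0 ?exprn_ge0// iter_adj_ge0.
  have : trans_prob R k o o <= (t / d%:R) ^+ k.
    have -> : trans_prob R k o o = (trans_prob R k o o `^ (k%:R^-1)) ^+ k.
      rewrite -powR_mulrn ?powR_ge0// -powRrM mulVf ?powRr1//.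
      by rewrite pnatr_eq0; case: (k) Nk.
    by rewrite lerXn2r ?nnegrE ?powR_ge0// divr_ge0 ?ltW.
  by rewrite tp expr_div_n mulrC ler_pM2r// invr_gt0 exprn_gt0.
have [a Ha] := adj_reach o y conn; have [b Hb] := adj_reach z o conn.
pose W k := iter k adj (fun x => (x == z)%:R) y.
have W0 k : 0 <= W k by exact: iter_adj_ge0.
have Wle k : W k <= iter (a + (k + b)) adj (fun x => (x == o)%:R) o.
  set u := fun x => (x == o)%:R.
  apply: (@le_trans _ _ (iter (k + b) adj u y)).
    rewrite iterD; apply: iter_adj_le => x; case: eqP => [->|_]; first exact: Hb.
    exact: iter_adj_ge0.
  set c := iter (k + b) adj u y.
  have c0 : 0 <= c by exact: iter_adj_ge0.
  apply: (@le_trans _ _ (iter a adj (fun x => c * (x == y)%:R) o)).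
    by rewrite iter_adjZ ler_peMr.
  rewrite iterD; apply: iter_adj_le => x; case: eqP => [->|_]; first by rewrite mulr1.
  by rewrite mulr0 iter_adj_ge0.
have S0 : 0 <= \sum_(k < K) W k / t ^+ k.
  by apply: sumr_ge0 => k _; rewrite divr_ge0// exprn_ge0// ltW.
exists (t ^+ (a + b) + \sum_(k < K) W k / t ^+ k).
  by rewrite addr_ge0// exprn_ge0// ltW.
move=> k; rewrite -/(W k); have tk : 0 < t ^+ k by rewrite exprn_gt0.
have [Kk|kK] := leqP K k.
  apply: le_trans (Wle k) _; apply: le_trans (HK _ _) _; first by lia.
  by rewrite addnCA addnC exprD ler_wpM2r ?lerDl// ltW.
rewrite -ler_pdivrMr// (bigD1 (Ordinal kK))//= addrCA lerDl.
rewrite addr_ge0 ?exprn_ge0 ?(ltW t0)//.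
by apply: sumr_ge0 => i _; rewrite divr_ge0// exprn_ge0// ltW.
Qed.

End Spectral.

(** * From nonbacktracking walks to simple random walk *)

Section Decay.
Variables (R : realType) (G : multigraph) (d : nat).
Hypothesis reg : regular G d.
Hypothesis d2 : (1 < d)%N.
Variable f : vertex G -> R.
Hypothesis f01 : forall x, 0 <= f x <= 1.
Hypothesis cesaro : forall eps : R, 0 < eps -> exists s : seq nat,
  [/\ s != [::], forall k, k \in s -> odd k &
   forall x, \sum_(k <- s) (d%:R * d.-1%:R ^+ k)^-1 * nbwalk_sum k.+1 f x
     <= eps * (size s)%:R].
Implicit Types (x y : vertex G) (u : vertex G -> R).
Local Notation adj := (@adj R G).

Definition srw_mean n x : R := (d%:R ^+ n)^-1 * iter n adj f x.
Local Notation p := srw_mean.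

Let dn n : 0 < d%:R ^+ n :> R.
Proof. by rewrite exprn_gt0// ltr0n ltnW. Qed.

Lemma iter_adj_cst n (c : R) x : iter n adj (fun=> c) x = d%:R ^+ n * c.
Proof.
elim: n x => [|n IH] x; first by rewrite mul1r.
by rewrite iterS (adj_ext IH) (adj_cst reg) exprS mulrA.
Qed.

Lemma srw_mean_iter n m x : p (m + n) x = (d%:R ^+ m)^-1 * iter m adj (p n) x.
Proof. by rewrite /p iter_adjZ iterD exprD invfM mulrA. Qed.

Lemma srw_mean_mono n m c : (forall x, p n x <= c) -> forall x, p (m + n) x <= c.
Proof.
move=> H x; rewrite srw_mean_iter ler_pdivrMl// -(iter_adj_cst _ _ x).
exact: iter_adj_le.
Qed.

Lemma srw_mean_ge0 n x : 0 <= p n x.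
Proof.
rewrite /p mulr_ge0 ?invr_ge0 ?(ltW (dn _))// iter_adj_ge0// => y.
by case/andP: (f01 y).
Qed.

(** Step out and back along the same edge. *)
Lemma adj2_ge u x : (forall y, 0 <= u y) -> u x <= adj (adj u) x.
Proof.
move=> u0; have : (0 < size (out x))%N by rewrite -/(deg x) reg ltnW.
case ox : (out x) => [//|e r] _.
have te : tail e = x by apply/eqP; rewrite -mem_out ox mem_head.
have := @adj_ge R G u (head e) (flip e) u0 (tail_flip e).
rewrite head_flip te => /le_trans; apply.
by apply: adj_ge => // y; exact: (@iter_adj_ge0 R G 1).
Qed.

Lemma iter_adj_even_le u x i j : (forall y, 0 <= u y) -> (i <= j)%N ->
  ~~ odd i -> ~~ odd j -> iter i adj u x <= iter j adj u x.
Proof.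
move=> u0 ij ei ej; have [k ->] : exists k, j = (k.*2 + i)%N.
  exists (j - i)./2; rewrite -[X in _ = (X + _)%N]/(_.*2).
  by move: (odd_double_half (j - i)); rewrite oddB// (negbTE ei) (negbTE ej) /=; lia.
rewrite iterD; have v0 y : 0 <= iter i adj u y by exact: iter_adj_ge0.
elim: k => [//|k IH]; apply: le_trans IH _; rewrite doubleS.
by apply: adj2_ge => y; exact: iter_adj_ge0.
Qed.

(** Let [m] be the infimum over [n] of the supremum of [p n]. If [m] is positive,
    take [n] with [p n] below [m + eta] everywhere and [x] with [p (K + n) x]
    above [m - eta]. The defect [g] is nonnegative and its sum over the walks of
    length [K] from [x] is at most [m / 2]. So are its sums over shorter walks of
    even length, by [adj2_ge], and over nonbacktracking ones, which are among
    them. Hence the nonbacktracking means of [p n] at [x] are at least [m / 2]. But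
    these means commute with the random walk, so that on average over the times
    in [s] they are at most [m / 4]. *)
Lemma srw_mean_small (x0 : vertex G) (eps : R) :
  0 < eps -> exists n, forall x, p n x <= eps.
Proof.
move=> eps0; pose A : set R := [set c | exists n, forall x, p n x <= c].
have A1 : A 1.
  exists 0%N => x; rewrite /p expr0 invr1 mul1r.
  by case/andP: (f01 x).
have A0 : lbound A 0.
  by move=> c [n /(_ x0)]; apply: le_trans; exact: srw_mean_ge0.
have infA : has_inf A by split; [exists 1 | exists 0].
have [m0|m_gt0] := leP (inf A) 0.
  have [c [n Hn] cm] := inf_adherent eps0 infA.
  by exists n => x; apply: le_trans (Hn x) _; lra.
set m := inf A in m_gt0.
have [|s [s0 s_odd Hs]] := cesaro (eps := m / 4); first by rewrite divr_gt0.
pose K := (\max_(k <- s) k.+1).*2.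
have sK k : k \in s -> (k.+1 <= K)%N.
  move=> ks; have : (k.+1 <= \max_(k <- s) k.+1)%N by exact: leq_bigmax_seq.
  by rewrite /K; lia.
(* [d ^ K * (2 * eta) = m / 2], the factor [d ^ K] being lost in [gK] *)
pose eta := m / (4 * d%:R ^+ K).
have eta0 : 0 < eta by rewrite divr_gt0// mulr_gt0.
have [c [n Hn] cm] := inf_adherent eta0 infA.
have pn y : p n y <= m + eta by apply: le_trans (Hn y) (ltW cm).
have [x Hx] : exists x, m - eta < p (K + n) x.
  apply: contrapT => noX; have : A (m - eta).
    exists (K + n)%N => x; rewrite leNgt; apply/negP => H; apply: noX.
    by exists x.
  move=> /(ge_inf infA.2); rewrite -/m; lra.
pose g y := m + eta - p n y.
have g0 y : 0 <= g y by rewrite subr_ge0.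
have gK : iter K adj g x <= m / 2.
  rewrite /g iter_adjB iter_adj_cst.
  have -> : iter K adj (p n) x = d%:R ^+ K * p (K + n) x.
    by rewrite srw_mean_iter mulrA divff ?mul1r// gt_eqF.
  rewrite -mulrBr; apply: le_trans (_ : d%:R ^+ K * (2 * eta) <= _).
    by rewrite ler_wpM2l ?(ltW (dn _))//; lra.
  rewrite /eta; have := dn K; set D := _ ^+ K => D0.
  have -> : D * (2 * (m / (4 * D))) = m / 2 by field; rewrite gt_eqF.
  by [].
have big k : k \in s ->
    m / 2 <= (d%:R * d.-1%:R ^+ k)^-1 * nbwalk_sum k.+1 (p n) x.
  move=> ks; set D := d%:R * _.
  have D1 : 1 <= D.
    by rewrite /D -natrX -natrM ler1n muln_gt0 expn_gt0; apply/andP; split; lia.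
  have D0 : 0 < D by exact: lt_le_trans D1.
  have E : D^-1 * nbwalk_sum k.+1 (p n) x
      = (m + eta) - D^-1 * nbwalk_sum k.+1 g x.
    rewrite /g nbwalk_sumB (nbwalk_sum_cst reg) -/D mulrBr mulrA mulVf ?gt_eqF//.
    by rewrite mul1r opprB addrC subrK.
  have : D^-1 * nbwalk_sum k.+1 g x <= m / 2.
    apply: le_trans gK; apply: le_trans (_ : nbwalk_sum k.+1 g x <= _).
      rewrite ler_piMl ?invf_le1//.
      by rewrite -(mulr0 D) -(nbwalk_sum_cst reg k 0 x) nbwalk_sum_le.
    apply: le_trans (nbwalk_sum_le_adj _ _ g0) _.
    by apply: iter_adj_even_le; rewrite ?sK ?odd_double//= s_odd.
  by rewrite E; lra.
have up : \sum_(k <- s) (d%:R * d.-1%:R ^+ k)^-1 * nbwalk_sum k.+1 (p n) x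
    <= m / 4 * (size s)%:R.
  pose v y := \sum_(k <- s) (d%:R * d.-1%:R ^+ k)^-1 * nbwalk_sum k.+1 f y.
  have -> : \sum_(k <- s) (d%:R * d.-1%:R ^+ k)^-1 * nbwalk_sum k.+1 (p n) x
      = (d%:R ^+ n)^-1 * iter n adj v x.
    rewrite /v iter_adj_sum mulr_sumr; apply: eq_bigr => k _.
    rewrite iter_adjZ mulrCA; congr (_ * _).
    by rewrite /p nbwalk_sumZ (nbwalk_sum_iter_adj reg).
  rewrite ler_pdivrMl// -(iter_adj_cst n _ x); exact: iter_adj_le.
have low : m / 2 * (size s)%:R
    <= \sum_(k <- s) (d%:R * d.-1%:R ^+ k)^-1 * nbwalk_sum k.+1 (p n) x.
  rewrite big_seq; apply: le_trans (ler_sum _ (fun k ks => big k ks)).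
  by rewrite -big_seq big_const_seq count_predT iter_addr_0 mulr_natr.
have := le_trans low up; rewrite ler_pM2r ?ltr0n ?lt0n ?size_eq0//.
by move=> H; exfalso; lra.
Qed.

Lemma srw_mean_cvg0 x : p n x @[n --> \oo] --> (0 : R).
Proof.
apply/cvgrPdist_le => eps eps0; have [n Hn] := srw_mean_small x eps0.
exists n => // k /= nk; rewrite sub0r normrN ger0_norm ?srw_mean_ge0//.
by rewrite -(subnK nk); exact: srw_mean_mono.
Qed.

End Decay.

Theorem theorem1p2 (R : realType) (G : multigraph) (d : nat) (L : nat)
    (hG : infinite_ramanujan R G d) (hL : (1 <= L)%N) (x : vertex G) :
  (fun n : nat => short_cycle_prob R L n x) @ \oo --> (0 : R).
Proof.
have [infG conn reg [x0 rho]] := hG.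
have d2 := degree_gt1 infG conn reg.
have -> : (fun n => short_cycle_prob R L n x)
    = (fun n => srw_mean d (@short_ind R G L) n x).
  apply/funext => n; rewrite /short_cycle_prob.
  by rewrite (srw_prob_adj R reg (on_short_cycle L)).
apply: (srw_mean_cvg0 reg d2).
  by move=> y; rewrite /short_ind ler0n lern1 leq_b1.
have [d3|] := ltnP 2 d; last first.
  move=> d2'; have d_eq : d = 2%N by lia.
  rewrite d_eq in reg *; exact: line_cesaro.
apply: (nb_cesaro reg d3) => m.
have q0 : 0 <= 4 * d.-1%:R :> R by rewrite mulr_ge0.
apply: (dot_adjm_le q0); exact: (growth_bound reg (ltnW d2) conn rho).
Qed.
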